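(* There exists a language $L_0$ over the six-symbol alphabet $\Sigma_0=\{a,b,c,d,e,\#\}$ such that $L_0$ is described by a grammar with left contexts and, for every finite alphabet $\Sigma$ and every language $L\subseteq\Sigma^*$ described by a grammar with left contexts, there is a homomorphism $h_L\colon\Sigma^*\to\Sigma_0^*$ such that $L=h_L^{-1}(L_0)$ if $\varepsilon\notin L$, and $L=h_L^{-1}(L_0\cup\{\varepsilon\})$ if $\varepsilon\in L$.
   Context: **Grammars with left contexts.** A grammar with left contexts is a quadruple $G=(\Sigma,N,R,S)$, where $\Sigma$ is a finite alphabet, $N$ is a finite set of nonterminal symbols disjoint from $\Sigma$, $S\in N$ is the initial symbol, and $R$ is a finite set of rules of the form $$A\to \alpha_1\,\&\,\ldots\,\&\,\alpha_k\,\&\,{\lhd}\beta_1\,\&\,\ldots\,\&\,{\lhd}\beta_m\,\&\,{\trianglelefteq}\gamma_1\,\&\,\ldots\,\&\,{\trianglelefteq}\gamma_n,$$ with $A\in N$, $k\ge 1$, $m,n\ge 0$, $\alpha_i,\beta_i,\gamma_i\in(\Sigma\cup N)^*$. For $u,v\in\Sigma^*$, write $u\langle v\rangle$ for the string $v$ in the left context $u$ (formally a pair $(u,v)$). Propositions $X(u\langle v\rangle)$, with $X\in\Sigma\cup N$, are derived as follows. Axioms: $a(x\langle a\rangle)$ for all $a\in\Sigma$, $x\in\Sigma^*$. Each rule $A\to \alpha_1\,\&\,\ldots\,\&\,\alpha_k\,\&\,{\lhd}\beta_1\,\&\,\ldots\,\&\,{\lhd}\beta_m\,\&\,{\trianglelefteq}\gamma_1\,\&\,\ldots\,\&\,{\trianglelefteq}\gamma_n$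 in $R$ allows one to derive $A(u\langle v\rangle)$ from already derived propositions if: (i) for every conjunct $\alpha_i=X_1\ldots X_\ell$ there is a partition $v=v_1\ldots v_\ell$ such that $X_j(uv_1\ldots v_{j-1}\langle v_j\rangle)$ is derived for all $j$; (ii) for every conjunct ${\lhd}\beta_i={\lhd}X_1\ldots X_\ell$ there is a partition $u=u_1\ldots u_\ell$ such that $X_j(u_1\ldots u_{j-1}\langle u_j\rangle)$ is derived for all $j$; (iii) for every conjunct ${\trianglelefteq}\gamma_i={\trianglelefteq}X_1\ldots X_\ell$ there is a partition $uv=w_1\ldots w_\ell$ such that $X_j(w_1\ldots w_{j-1}\langle w_j\rangle)$ is derived for all $j$. For $\ell=0$ these conditions mean $v=\varepsilon$, $u=\varepsilon$, $uv=\varepsilon$, respectively. The language described by $G$ is $L(G)=\{w\in\Sigma^*\mid S(\varepsilon\langle w\rangle)\text{ is derivable}\}$. A homomorphism $h\colon\Sigma^*\to\Sigma_0^*$ is a monoid homomorphism of free monoids, and $h^{-1}(K)=\{w\in\Sigma^*\mid h(w)\in K\}$. *)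

(* Defs.v *)
From HB Require Import structures.
From mathcomp Require Import all_boot all_classical.

Set Implicit Arguments.
Unset Strict Implicit.
Unset Printing Implicit Defensive.

Local Open Scope classical_set_scope.

Section Rules.
Variables Sigma N : finType.

(* The sum type makes the two alphabets disjoint. *)
Definition symbol : Type := (Sigma + N)%type.
HB.instance Definition _ := Finite.on symbol.

(* A -> alpha_1 & ... & alpha_k & <|beta_1 & ... & <|beta_m
        & <|=gamma_1 & ... & <|=gamma_n;
   the condition k >= 1 is imposed in [grammar]. *)
Record rule := Rule {
  lhs : N;
  base_conjuncts : seq (seq symbol);      (* the alpha_i *)
  left_conjuncts : seq (seq symbol);      (* the beta_i *)
  extleft_conjuncts : seq (seq symbol)    (* the gamma_i *)
}.

Definition rule_tuple (r : rule) :=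
  (lhs r, base_conjuncts r, left_conjuncts r, extleft_conjuncts r).
Definition tuple_rule t : rule := let: (A, bs, ls, es) := t in Rule A bs ls es.
Lemma rule_tupleK : cancel rule_tuple tuple_rule. Proof. by case. Qed.
HB.instance Definition _ := Equality.copy rule (can_type rule_tupleK).

End Rules.

Record grammar (Sigma : finType) := Grammar {
  nonterm : finType;
  rules : seq (rule Sigma nonterm);
  start : nonterm;
  rules_base : all (fun r => base_conjuncts r != [::]) rules
}.

(* [derives G X u v] is the derivability of the proposition X(u<v>);
   [derives_seq G [:: X_1; ...; X_l] u v] says that v has a partition
   v_1 ... v_l with each X_j(u v_1 ... v_(j-1)<v_j>) derivable. *)
Inductive derives (Sigma : finType) (G : grammar Sigma) :
    symbol Sigma (nonterm G) -> seq Sigma -> seq Sigma -> Prop :=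
| derives_axiom (a : Sigma) (x : seq Sigma) : derives (inl a) x [:: a]
| derives_rule (r : rule Sigma (nonterm G)) (u v : seq Sigma) :
    r \in rules G ->
    (forall alpha, alpha \in base_conjuncts r -> derives_seq alpha u v) ->
    (forall beta, beta \in left_conjuncts r -> derives_seq beta [::] u) ->
    (forall gamma, gamma \in extleft_conjuncts r ->
       derives_seq gamma [::] (u ++ v)) ->
    derives (inr (lhs r)) u v
with derives_seq (Sigma : finType) (G : grammar Sigma) :
    seq (symbol Sigma (nonterm G)) -> seq Sigma -> seq Sigma -> Prop :=
| derives_nil (u : seq Sigma) : derives_seq [::] u [::]
| derives_cons (X : symbol Sigma (nonterm G))
    (Xs : seq (symbol Sigma (nonterm G))) (u v1 v2 : seq Sigma) :
    derives X u v1 -> derives_seq Xs (u ++ v1) v2 ->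
    derives_seq (X :: Xs) u (v1 ++ v2).

Scheme derives_mut := Minimality for derives Sort Prop
with derives_seq_mut := Minimality for derives_seq Sort Prop.
Combined Scheme derives_combined from derives_mut, derives_seq_mut.

Definition language (Sigma : finType) (G : grammar Sigma) : set (seq Sigma) :=
  [set w | derives (inr (start G)) [::] w].

Definition described_by_left_contexts (Sigma : finType)
    (L : set (seq Sigma)) : Prop :=
  exists G : grammar Sigma, L = language G.

Definition string_morphism (A B : Type) (h : seq A -> seq B) : Prop :=
  h [::] = [::] /\ {morph h : u v / u ++ v}.

Inductive sigma0 := sym_a | sym_b | sym_c | sym_d | sym_e | sym_hash.

Definition sigma0_rank (x : sigma0) : 'I_6 :=
  match x with
  | sym_a => @Ordinal 6 0 isT
  | sym_b => @Ordinal 6 1 isT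
  | sym_c => @Ordinal 6 2 isT
  | sym_d => @Ordinal 6 3 isT
  | sym_e => @Ordinal 6 4 isT
  | sym_hash => @Ordinal 6 5 isT
  end.
Definition sigma0_unrank (i : 'I_6) : sigma0 :=
  nth sym_a [:: sym_a; sym_b; sym_c; sym_d; sym_e; sym_hash] i.
Lemma sigma0_rankK : cancel sigma0_rank sigma0_unrank.
Proof. by case. Qed.
HB.instance Definition _ := Finite.copy sigma0 (can_type sigma0_rankK).

(* Main.v *)
(** The image of a letter x is [E e a^n d E], where n is the number of x and E is
    a dictionary describing the whole grammar G.  A position k of the word w is
    thus visible in the image as the two copies of E between the k-th and the
    (k+1)-st symbol e, and a proposition about the factor between the positions
    i and j is represented by a substring of the image that starts near i and
    ends near j.  Which proposition is meant is told by a code standing either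
    at the end or at the start of that substring: a disjunction of conjunctions
    of atom numbers.  A binary atom "B on (i,m) and C on (m,j)" is verified by
    matching its unary number with the same number in the dictionary at the
    position m, where to_item is written between a code of B (the end of the left
    part) and a code of C (the start of the right part).

    As codes can only be followed into strictly smaller factors, G is first
    brought to a form in which every step splits a nonempty factor properly.
    For a prefix u let tau u be the set of all A with A(eps<u>).  What holds at
    (u, v), v nonempty, is a propositional consequence of tau u, tau (uv), the
    letter v and the proper splittings of v; what holds at (u, eps) is a
    consequence of tau u.  So a code carries assumptions on tau at both ends.
    The assumption on tau at a splitting position m is verified right there, on
    the prefix of length m, through an increasing chain of sets 0 = T_0, T_1,
    ..., where every member of T_(t+1) is derived assuming only T_t at m. *)

Require Import Defs.
From HB Require Import structures.
From mathcomp Require Import all_boot all_classical zify.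

Set Implicit Arguments.
Unset Strict Implicit.
Unset Printing Implicit Defensive.

(** * Cutting words at marked symbols *)

Section Cuts.
Variable T : eqType.
Implicit Types (x y z s t : seq T) (a b : T) (p : pred T).

Lemma cat_eq_cut x y z t a : x ++ y = z ++ a :: t ->
  (exists2 q, x = z ++ a :: q & t = q ++ y) \/
  (exists2 q, z = x ++ q & y = q ++ a :: t).
Proof.
elim: x z => [|b x IHx] [|c z] /=.
- by move=> ->; right; exists [::].
- by move=> ->; right; exists (c :: z).
- by case=> <- <-; left; exists x.
case=> <- /IHx [[q -> ->]|[q -> ->]]; first by left; exists q.
by right; exists q.
Qed.

Lemma span_inj p x y z t a b : all p x -> all p z -> ~~ p a -> ~~ p b ->
  x ++ a :: y = z ++ b :: t -> [/\ x = z, a = b & y = t].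
Proof.
elim: x z => [|c x IHx] [|c' z] //=.
- by move=> _ _ _ _ [-> ->].
- by move=> _ /andP[pc' _] /negP Na _ [ac _]; case: Na; rewrite ac.
- by move=> /andP[pc _] _ _ /negP Nb [cb _]; case: Nb; rewrite -cb.
by move=> /andP[_ px] /andP[_ pz] pa pb [<-] /(IHx _ px pz pa pb)[-> -> ->].
Qed.

Lemma span_inj_rev p x y z t a b : all p y -> all p t -> ~~ p a -> ~~ p b ->
  x ++ a :: y = z ++ b :: t -> [/\ x = z, a = b & y = t].
Proof.
move=> py pt pa pb /(congr1 rev); rewrite !rev_cat !rev_cons !cat_rcons.
case/(@span_inj p); rewrite ?all_rev // => /(can_inj revK)-> -> eq_xz.
by rewrite (can_inj revK eq_xz).
Qed.

Lemma uniq_cut x y z t a : a \notin x -> a \notin y ->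
  x ++ a :: y = z ++ a :: t -> x = z /\ y = t.
Proof.
move=> ax ay /cat_eq_cut[[q eq_x]|[[|b q] ->]] /=.
- by rewrite eq_x mem_cat mem_head orbT in ax.
- by case=> ->; rewrite cats0.
by case=> _ eq_y; rewrite eq_y mem_cat mem_head orbT in ay.
Qed.

Lemma flatten_cut (ss : seq (seq T)) x y a : flatten ss = x ++ a :: y ->
  exists (s1 : seq (seq T)) s (s2 : seq (seq T)) t1 t2,
    [/\ ss = s1 ++ s :: s2, s = t1 ++ a :: t2,
    x = flatten s1 ++ t1 & y = t2 ++ flatten s2].
Proof.
elim: ss x => [|s ss IHss] x /=; first by case: x.
move=> /cat_eq_cut[[q -> ->]|[q -> /IHss[s1 [s' [s2 [t1 [t2 [-> -> -> ->]]]]]]]].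
  by exists [::], (x ++ a :: q), ss, x, q.
by exists (s :: s1), (t1 ++ a :: t2), s2, t1, t2; rewrite /= catA.
Qed.

Lemma flatten_rcons_cut (I : eqType) (f : I -> seq T) (D : seq I) b x y :
    (forall i, b \notin f i) ->
    flatten [seq f i ++ [:: b] | i <- D] = x ++ b :: y ->
  exists D1 i D2, [/\ D = D1 ++ i :: D2,
    x = flatten [seq f i ++ [:: b] | i <- D1] ++ f i &
    y = flatten [seq f i ++ [:: b] | i <- D2]].
Proof.
move=> bf; elim: D x => [|i D IHD] x /=; first by case: x.
rewrite -catA => /cat_eq_cut[[q fiE]|[[|c q] -> /=]].
- by have:= bf i; rewrite fiE mem_cat inE eqxx orbT.
- by case=> <-; exists [::], i, D; rewrite cats0.
case=> <- /IHD[D1 [i' [D2 [-> -> ->]]]].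
by exists (i :: D1), i', D2; rewrite /= -!catA.
Qed.

(** The [b] in front of a code is shifted to the end, so each conjunction in it has a [b] on both
    sides, whether it comes first or not. *)
Lemma flatten_rcons_last (I : Type) (f : I -> seq T) (D : seq I) b :
  exists u, b :: flatten [seq f i ++ [:: b] | i <- D] = u ++ [:: b].
Proof.
elim/last_ind: D => [|D i _]; first by exists [::].
exists (b :: flatten [seq f i ++ [:: b] | i <- D] ++ f i).
by rewrite map_rcons flatten_rcons /= -catA.
Qed.

(** The number of [a] in the two prefixes decides on which side of the cut the displayed [a] falls.
    This is used with ['e], whose count is the position in the word. *)
Lemma cut_le A B x y a : A ++ a :: B = x ++ y ->
  (count_mem a x <= count_mem a A)%N -> exists2 q, A = x ++ q & y = q ++ a :: B.
Proof.
move=> /esym/cat_eq_cut[[q ->]|[q -> ->]]; last by exists q.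
by rewrite count_cat /= eqxx addnA addn1 addSn ltnNge leq_addr.
Qed.

Lemma cut_gt A B x y a : A ++ a :: B = x ++ y ->
  (count_mem a A < count_mem a x)%N -> exists2 q, x = A ++ a :: q & B = q ++ y.
Proof.
move=> /esym/cat_eq_cut[[q -> ->]|[q -> _]]; first by exists q.
by rewrite count_cat ltnNge leq_addr.
Qed.

Lemma flatten_mem (ss : seq (seq T)) s : s \in ss ->
  exists x y, flatten ss = x ++ s ++ y.
Proof.
by case/splitPr=> s1 s2; exists (flatten s1), (flatten s2); rewrite flatten_cat.
Qed.

Lemma all_flattenP (I : eqType) (f : I -> seq T) (s : seq I) p :
  (forall i, all p (f i)) -> all p (flatten (map f s)).
Proof. by move=> pf; elim: s => //= i s IHs; rewrite all_cat pf. Qed.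

End Cuts.

(** * Grammars *)

Section Grammar.
Variables (Sigma : finType) (G : grammar Sigma).
Implicit Types (X : symbol Sigma (nonterm G)) (u v x y : seq Sigma).

Lemma derives_cat X Xs u v v1 v2 : v = v1 ++ v2 ->
  derives X u v1 -> derives_seq Xs (u ++ v1) v2 -> derives_seq (X :: Xs) u v.
Proof. by move=> ->; apply: derives_cons. Qed.

Lemma derives_term a (Xs : seq (symbol Sigma (nonterm G))) u v :
  derives_seq Xs (u ++ [:: a]) v -> derives_seq (inl a :: Xs) u (a :: v).
Proof.
by move=> dXs; apply: (@derives_cons _ G (inl a) Xs u [:: a]); first exact: derives_axiom.
Qed.

Lemma derives_seq1 X u v : derives_seq [:: X] u v <-> derives X u v.
Proof.
split=> [dX|dX]; last by apply: (derives_cat _ dX (derives_nil _ _)); rewrite cats0.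
move E: [:: X] dX => Xs dX; case: dX E => // X' Xs' u' v1 v2 dX' dXs [-> eXs].
by rewrite -{}eXs in dXs; inversion dXs; rewrite cats0.
Qed.

Section Model.
Variables (H : seq Sigma) (Sem : nonterm G -> seq Sigma -> seq Sigma -> Prop).

Definition sem_symbol X u v :=
  match X with inl a => v = [:: a] | inr A => Sem A u v end.

Fixpoint sem_seq Xs u v : Prop :=
  if Xs is X :: Xs' then
    exists v1 v2, [/\ v = v1 ++ v2, sem_symbol X u v1 & sem_seq Xs' (u ++ v1) v2]
  else v = [::].

Hypothesis Sem_rule : forall r u v, r \in rules G -> prefix (u ++ v) H ->
  (forall alpha, alpha \in base_conjuncts r -> sem_seq alpha u v) ->
  (forall beta, beta \in left_conjuncts r -> sem_seq beta [::] u) ->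
  (forall gamma, gamma \in extleft_conjuncts r -> sem_seq gamma [::] (u ++ v)) ->
  Sem (lhs r) u v.

(** All propositions used in a derivation on a prefix of [H] concern prefixes of [H] again, context
    conjuncts included. Hence invariants may refer to [H] and need checking for single rules
    only. *)
Lemma derives_sem :
  (forall X u v, derives X u v -> prefix (u ++ v) H -> sem_symbol X u v) /\
  (forall Xs u v, derives_seq Xs u v -> prefix (u ++ v) H -> sem_seq Xs u v).
Proof.
apply: derives_combined => //=.
- move=> r u v r_in _ IHb _ IHl _ IHe pre_uv; apply: Sem_rule => //.
  + by move=> alpha /IHb; apply.
  + by move=> beta /IHl; apply; apply: catl_prefix pre_uv.
  + by move=> gamma /IHe; apply.
- move=> X Xs u v1 v2 _ IHX _ IHXs; rewrite catA => pre_uv; exists v1, v2; split=> //.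
    by apply/IHX/catl_prefix/pre_uv.
  exact: IHXs.
Qed.

End Model.
End Grammar.

(** * The universal grammar *)

(* EndCode reads a code at the end of its string, StartCode at the start.
   They choose one conjunction (EndRule, StartRule) of the code; every atom
   number in it is read by EndAtom or StartAtom, and EndPair and EndLetter
   (StartPair and StartLetter) match this number with its other occurrence,
   in the dictionary or in a letter block.  PrefixCheck derives only the empty
   string, after a left context derived by EndCode; Checks and RootChecks run
   through a list of codes with a PrefixCheck after each of them. *)
Inductive nt0 := Start | RootChecks | Checks | PrefixCheck
  | EndCode | EndRule | EndAtom | EndPair | EndLetter
  | StartCode | StartRule | StartAtom | StartPair | StartLetter
  | AnyString | CodeString | NoLetter | UnaryString.

Definition nt0_enum :=
  [:: Start; RootChecks; Checks; PrefixCheck;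
      EndCode; EndRule; EndAtom; EndPair; EndLetter;
      StartCode; StartRule; StartAtom; StartPair; StartLetter;
      AnyString; CodeString; NoLetter; UnaryString].
Definition nt0_rank (A : nt0) : 'I_18 :=
  match A with
  | Start => @Ordinal 18 0 isT | RootChecks => @Ordinal 18 1 isT
  | Checks => @Ordinal 18 2 isT | PrefixCheck => @Ordinal 18 3 isT
  | EndCode => @Ordinal 18 4 isT | EndRule => @Ordinal 18 5 isT
  | EndAtom => @Ordinal 18 6 isT | EndPair => @Ordinal 18 7 isT
  | EndLetter => @Ordinal 18 8 isT | StartCode => @Ordinal 18 9 isT
  | StartRule => @Ordinal 18 10 isT | StartAtom => @Ordinal 18 11 isT
  | StartPair => @Ordinal 18 12 isT | StartLetter => @Ordinal 18 13 isT
  | AnyString => @Ordinal 18 14 isT | CodeString => @Ordinal 18 15 isT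
  | NoLetter => @Ordinal 18 16 isT | UnaryString => @Ordinal 18 17 isT
  end.
Lemma nt0_rankK : cancel nt0_rank (fun i : 'I_18 => nth Start nt0_enum i).
Proof. by case. Qed.
HB.instance Definition _ := Finite.copy nt0 (can_type nt0_rankK).

Local Notation "'a" := sym_a.
Local Notation "'b" := sym_b.
Local Notation "'c" := sym_c.
Local Notation "'d" := sym_d.
Local Notation "'e" := sym_e.
Local Notation "'#" := sym_hash.

Definition all_symbols := [:: 'a; 'b; 'c; 'd; 'e; '#].
Definition code_symbols := [:: 'a; 'b; '#].
Definition nonletter_symbols := [:: 'a; 'b; 'c; 'd; '#].

Definition tm (x : sigma0) : symbol sigma0 nt0 := inl x.
Definition nt (A : nt0) : symbol sigma0 nt0 := inr A.

Definition star_rules (A : nt0) (l : seq sigma0) : seq (rule sigma0 nt0) :=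
  Rule A [:: [::]] [::] [::] :: [seq Rule A [:: [:: tm x; nt A]] [::] [::] | x <- l].

Definition plain A (alpha : seq (symbol sigma0 nt0)) := Rule A [:: alpha] [::] [::].

(** The two-conjunct rules read the same string twice: one conjunct passes over the outermost
    number, the other verifies it. The rules with ['a] on both sides compare two unary numbers
    around a middle part. *)
Definition main_rules0 : seq (rule sigma0 nt0) :=
  [:: plain Start [:: nt AnyString; tm 'c; nt RootChecks];
      plain RootChecks [:: tm 'd; tm 'b; nt CodeString; nt PrefixCheck; nt RootChecks];
      plain RootChecks [:: tm 'd; tm 'd; tm 'd; nt NoLetter];
      plain Checks [:: tm 'd; tm 'b; nt CodeString; nt PrefixCheck; nt Checks];
      plain Checks [:: tm 'd; tm 'd; nt StartCode];
      Rule PrefixCheck [:: [::]] [::] [:: [:: nt EndCode]];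
      plain EndCode [:: nt EndRule; tm 'b; nt CodeString];
      plain EndRule [:: nt AnyString; tm 'b];
      Rule EndRule [:: [:: nt EndRule; tm '#; nt UnaryString]; [:: nt EndAtom]] [::] [::];
      plain EndAtom [:: nt EndCode; tm 'c; nt EndPair];
      plain EndAtom [:: nt NoLetter; tm 'e; nt EndLetter];
      plain EndPair [:: tm 'a; nt EndPair; tm 'a];
      plain EndPair [:: nt Checks; tm '#];
      plain EndLetter [:: tm 'a; nt EndLetter; tm 'a];
      plain EndLetter [:: tm 'd; nt NoLetter; tm '#];
      plain StartCode [:: nt CodeString; tm 'b; nt StartRule];
      plain StartRule [:: tm 'b; nt AnyString];
      Rule StartRule [:: [:: nt UnaryString; tm '#; nt StartRule]; [:: nt StartAtom]] [::] [::];
      plain StartAtom [:: nt StartPair; nt Checks];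
      plain StartAtom [:: nt StartLetter; tm 'd; nt NoLetter];
      plain StartPair [:: tm 'a; nt StartPair; tm 'a];
      plain StartPair [:: tm '#; nt EndCode; tm 'c];
      plain StartLetter [:: tm 'a; nt StartLetter; tm 'a];
      plain StartLetter [:: tm '#; nt NoLetter; tm 'e] ].

Definition rules0 := main_rules0 ++ star_rules AnyString all_symbols
  ++ star_rules CodeString code_symbols ++ star_rules NoLetter nonletter_symbols
  ++ star_rules UnaryString [:: 'a].

Lemma rules0_base : all (fun r => base_conjuncts r != [::]) rules0.
Proof. by []. Qed.

Definition G0 : grammar sigma0 := Grammar Start rules0_base.

Lemma derives_plain A alpha u v : plain A alpha \in rules0 ->
  @derives_seq _ G0 alpha u v -> @derives _ G0 (inr A) u v.
Proof.
move=> r_in d_alpha; apply: (@derives_rule _ G0 (plain A alpha)) => //=.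
by move=> alpha'; rewrite inE => /eqP->.
Qed.

Lemma derives_and A alpha1 alpha2 u v :
  Rule A [:: alpha1; alpha2] [::] [::] \in rules0 ->
  @derives_seq _ G0 alpha1 u v -> @derives_seq _ G0 alpha2 u v ->
  @derives _ G0 (inr A) u v.
Proof.
move=> r_in d1 d2; apply: (@derives_rule _ G0 (Rule A [:: alpha1; alpha2] [::] [::])) => //=.
by move=> alpha'; rewrite !inE => /orP[] /eqP->.
Qed.

Lemma derives_star A l u v : {subset star_rules A l <= rules0} ->
  {subset v <= l} -> @derives _ G0 (inr A) u v.
Proof.
move=> sub; elim: v u => [|x v IHv] u vl.
  by apply: derives_plain (derives_nil _ _); rewrite sub ?inE ?eqxx.
apply: (@derives_plain A [:: tm x; nt A]).
  apply: sub; rewrite in_cons; apply/orP; right.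
  by apply/mapP; exists x; rewrite ?vl ?mem_head.
apply: derives_term; apply/derives_seq1/IHv => y y_v.
by rewrite vl // inE y_v orbT.
Qed.

Lemma derives_AnyString u v : @derives _ G0 (inr AnyString) u v.
Proof. by apply: (@derives_star _ all_symbols) => [r r_in|[]//]; rewrite !mem_cat r_in !orbT. Qed.

Lemma derives_CodeString u v : {subset v <= code_symbols} -> @derives _ G0 (inr CodeString) u v.
Proof. by apply: derives_star => r r_in; rewrite !mem_cat r_in !orbT. Qed.

Lemma derives_NoLetter u v : 'e \notin v -> @derives _ G0 (inr NoLetter) u v.
Proof.
move=> ev; apply: (@derives_star _ nonletter_symbols) => [r r_in|].
  by rewrite !mem_cat r_in !orbT.
by case=> // ev'; rewrite ev' in ev.
Qed.

Lemma derives_UnaryString u k : @derives _ G0 (inr UnaryString) u (nseq k 'a).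
Proof.
apply: (@derives_star _ [:: 'a]) => [r r_in|x]; first by rewrite !mem_cat r_in !orbT.
by rewrite mem_nseq inE => /andP[].
Qed.

(** * Codes *)

Definition code := seq (seq nat).
(* The cell (B, n, Ds, C) says: the atom n holds between i and j as soon as, for
   some m, B holds between i and m, C between m and j, and each code in Ds
   between 0 and m. *)
Definition cell : Type := (code * nat * seq code * code)%type.

Local Notation una k := (nseq k 'a).
(* Codes in the mirrored formats expected by EndCode (l) and StartCode (r). *)
Definition lrule (ks : seq nat) := flatten [seq '# :: una k | k <- ks].
Definition rrule (ks : seq nat) := flatten [seq una k ++ [:: '#] | k <- ks].
Definition lbody (D : code) := flatten [seq lrule ks ++ [:: 'b] | ks <- D].
Definition rbody (D : code) := flatten [seq rrule ks ++ [:: 'b] | ks <- D].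
Definition lcode D := 'd :: 'b :: lbody D.
Definition rcode D := 'b :: rbody D.
Definition lcodes (Ds : seq code) := flatten (map lcode Ds).
Definition cell_str (x : cell) := let: (B, n, Ds, C) := x in
  lcode B ++ 'c :: una n ++ lcodes Ds ++ [:: 'd, 'd & rcode C ++ [:: 'd]].
Definition root_str (Ds : seq code) := 'c :: lcodes Ds ++ [:: 'd; 'd; 'd].

Definition rule_symbols := [:: 'a; '#].

Lemma una_a k : all (pred1 'a) (una k). Proof. by rewrite all_nseq /= eqxx orbT. Qed.

Lemma lrule_in ks : all (mem rule_symbols) (lrule ks).
Proof. by apply: all_flattenP => k; rewrite /= all_nseq orbT. Qed.

Lemma rrule_in ks : all (mem rule_symbols) (rrule ks).
Proof.
by apply: all_flattenP => k; rewrite /= all_cat all_nseq orbT.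
Qed.

Lemma rule_code_symbols v : all (mem rule_symbols) v -> all (mem code_symbols) v.
Proof. by apply: sub_all; case. Qed.

Lemma lbody_in D : all (mem code_symbols) (lbody D).
Proof.
apply: all_flattenP => ks.
by rewrite all_cat rule_code_symbols ?lrule_in.
Qed.

Lemma rbody_in D : all (mem code_symbols) (rbody D).
Proof.
apply: all_flattenP => ks.
by rewrite all_cat rule_code_symbols ?rrule_in.
Qed.

Lemma lcodes_in Ds : all (mem [:: 'a; 'b; 'd; '#]) (lcodes Ds).
Proof.
apply: all_flattenP => D.
by apply: sub_all (lbody_in D); case.
Qed.

Lemma all_notin (T : eqType) (p : pred T) v x : all p v -> ~~ p x -> x \notin v.
Proof. by move=> /allP pv; apply: contra => /pv. Qed.

Lemma count_all0 (T : eqType) (p : pred T) v x : all p v -> ~~ p x -> count_mem x v = 0.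
Proof. by move=> pv /(all_notin pv)/count_memPn. Qed.

Lemma rrule_inj : injective rrule.
Proof.
elim=> [|k ks IHks] [|m ms] //; [by case: m | by case: k | rewrite /rrule /= -!catA /=].
move/(@span_inj _ (pred1 'a)); rewrite !una_a => -[] // /(congr1 size).
by rewrite !size_nseq => <- _ /IHks->.
Qed.

Lemma lrule_inj : injective lrule.
Proof.
(* Shifting the marks by one ['#] turns one format into the other, which transfers injectivity. *)
have E ks : lrule ks ++ [:: '#] = '# :: rrule ks.
  by elim: ks => //= k ks IHks; rewrite /lrule /rrule /= -!catA /= -/(lrule ks) IHks.
by move=> ks ms eq_kms; apply: rrule_inj; have:= E ks; rewrite eq_kms E => -[].
Qed.

(** As [y] has no ['d], the ['d] opening the code comes before the last displayed ['b]. So that ['b]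
    ends a conjunction of [D], and the run of ['a] and ['#] before it is this whole conjunction. *)
Lemma lcode_parse z D z' ks y : all (mem code_symbols) y ->
  z ++ lcode D = z' ++ 'b :: lrule ks ++ 'b :: y -> ks \in D.
Proof.
move=> y_in; rewrite -cat_cons catA => /esym/cat_eq_cut[[[|ch q] eq_q eq_y]|[q _ eq_q]].
- by case/(@span_inj_rev _ (mem rule_symbols)): eq_q => //; apply: lrule_in.
- case: eq_y => chE; subst ch => /(@flatten_rcons_cut _ _ lrule)[].
    by move=> ms; apply: all_notin (lrule_in ms) _.
  move=> D1 [ms [D2 [-> eq1 _]]]; move: eq_q; rewrite {}eq1.
  have [u eq_u] := flatten_rcons_last lrule D1 'b.
  rewrite -[_ :: _ ++ _]cat_cons eq_u -catA -cat_cons catA.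
  case/(@span_inj_rev _ (mem rule_symbols)); rewrite ?lrule_in // => _ _ /lrule_inj ->.
  by rewrite mem_cat mem_head orbT.
have: 'd \notin 'b :: y by apply: all_notin (_ : all (mem code_symbols) _) _.
by rewrite eq_q mem_cat mem_head orbT.
Qed.

Lemma rcode_parse y ks t D s : all (mem code_symbols) y ->
  y ++ 'b :: rrule ks ++ 'b :: t = rcode D ++ 'd :: s -> ks \in D.
Proof.
move=> y_in /esym/cat_eq_cut[[q eq_q eq_t]|[q eq_q eq_d]]; last first.
  have: 'd \notin y by apply: all_notin y_in _.
  rewrite eq_q mem_cat; case: q eq_d {eq_q} => // ch q [<- _].
  by rewrite mem_head orbT.
have [D1 [D2 [eqD eq2]]] : exists D1 D2, D = D1 ++ D2 /\ q = rbody D2.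
  case: y eq_q {y_in} => [[<-]|ch y [_]]; first by exists [::], D.
  case/(@flatten_rcons_cut _ _ rrule) => [ms|D1 [ms [D2 [-> _ ->]]]].
    by apply: all_notin (rrule_in ms) _.
  by exists (D1 ++ [:: ms]), D2; rewrite -catA.
rewrite eqD mem_cat; case: D2 eq2 {eqD eq_q} => [|ms D2] eq2; move: eq_t; rewrite eq2.
  by case/(@span_inj _ (mem rule_symbols) _ _ [::]); rewrite ?rrule_in.
rewrite /= -!catA /=; case/(@span_inj _ (mem rule_symbols)); rewrite ?rrule_in //.
by move=> /rrule_inj->; rewrite mem_head orbT.
Qed.

(* For a prefix s of the image of w, [ne s] is the position in w reached by s. *)
Definition ne (s : seq sigma0) : nat := count_mem 'e s.

Lemma ne_cat x y : ne (x ++ y) = ne x + ne y. Proof. exact: count_cat. Qed.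
Lemma ne_cons a x : ne (a :: x) = (a == 'e) + ne x. Proof. by []. Qed.
Lemma ne_nil : ne [::] = 0. Proof. by []. Qed.

Lemma una_notin k x : x != 'a -> x \notin una k.
Proof. by move=> xa; rewrite mem_nseq negb_and xa orbT. Qed.

Lemma ne_una k : ne (una k) = 0.
Proof. by apply/count_memPn/una_notin. Qed.

Lemma ne_lcodes Ds : ne (lcodes Ds) = 0.
Proof. exact: count_all0 (lcodes_in Ds) _. Qed.

Lemma ne_cut_le A B x y : A ++ 'e :: B = x ++ y -> ne x <= ne A ->
  exists2 q, A = x ++ q & y = q ++ 'e :: B.
Proof. exact: cut_le. Qed.

Lemma ne_cut_gt A B x y : A ++ 'e :: B = x ++ y -> ne A < ne x ->
  exists2 q, x = A ++ 'e :: q & B = q ++ y.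
Proof. exact: cut_gt. Qed.

Lemma ne_lcode D : ne (lcode D) = 0.
Proof. by have:= ne_lcodes [:: D]; rewrite /lcodes /= cats0. Qed.

Lemma ne_codes y : all (mem code_symbols) y -> ne y = 0.
Proof. by move=> y_in; apply: count_all0 y_in _. Qed.

Lemma ne_lbody D : ne (lbody D) = 0. Proof. exact/ne_codes/lbody_in. Qed.
Lemma ne_rbody D : ne (rbody D) = 0. Proof. exact/ne_codes/rbody_in. Qed.
Lemma ne_lrule ks : ne (lrule ks) = 0. Proof. exact/ne_codes/rule_code_symbols/lrule_in. Qed.
Lemma ne_rrule ks : ne (rrule ks) = 0. Proof. exact/ne_codes/rule_code_symbols/rrule_in. Qed.

Ltac cats := do 3 rewrite -?catA /=.
Ltac nes :=
  rewrite ?(ne_una, ne_lcodes, ne_lcode, ne_lbody, ne_rbody, ne_lrule, ne_rrule,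
            ne_cat, ne_cons, ne_nil) /=; try lia.

(** * The encoding of words and the meaning of numbers and codes *)

Section Encoding.
Variables (Sigma : finType) (letter_id : Sigma -> nat).
Variables (cells : seq cell) (roots : seq (seq code)).

Section Holds.
Variable w : seq Sigma.

(* [holds D i j] refers to the factor of w between the positions i and j; as the
   same number may belong to a letter and to cells, [sat] allows any reading. *)
Inductive holds : code -> nat -> nat -> Prop :=
| Holds (D : code) (ks : seq nat) i j :
    ks \in D -> (forall k, k \in ks -> sat k i j) -> holds D i j
with sat : nat -> nat -> nat -> Prop :=
| SatLetter w1 x w2 :
    w = w1 ++ x :: w2 -> sat (letter_id x) (size w1) (size w1).+1
| SatPair B n Ds C i m j :
    (B, n, Ds, C) \in cells -> holds B i m -> holds C m j ->
    (forall D, D \in Ds -> holds D 0 m) -> sat n i j.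

Scheme holds_mut := Minimality for holds Sort Prop
with sat_mut := Minimality for sat Sort Prop.
Combined Scheme holds_combined from holds_mut, sat_mut.

End Holds.

Definition dict := map cell_str cells ++ map root_str roots.
Definition block (x : Sigma) :=
  flatten dict ++ 'e :: una (letter_id x) ++ 'd :: flatten dict.
Definition hom (w : seq Sigma) := flatten (map block w).

Lemma hom_cat : {morph hom : u v / u ++ v}.
Proof. by move=> u v; rewrite /hom map_cat flatten_cat. Qed.

Lemma lcode_in D : all (mem [:: 'a; 'b; 'd; '#]) (lcode D).
Proof. by have:= lcodes_in [:: D]; rewrite /lcodes /= cats0. Qed.

Lemma cell_tail_in n Ds C :
  all (mem [:: 'a; 'b; 'd; '#]) (una n ++ lcodes Ds ++ [:: 'd, 'd & rcode C ++ [:: 'd]]).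
Proof.
rewrite !all_cat all_nseq /= orbT lcodes_in /= all_cat andbT.
by apply: sub_all (rbody_in C); case.
Qed.

Lemma cell_str_notin_e x : 'e \notin cell_str x.
Proof.
case: x => [[[B n] Ds] C]; rewrite /cell_str mem_cat negb_or (all_notin (lcode_in _)) //.
by rewrite in_cons negb_or (all_notin (cell_tail_in _ _ _)).
Qed.

Lemma root_str_notin_e Ds : 'e \notin root_str Ds.
Proof. by rewrite in_cons mem_cat !negb_or (all_notin (lcodes_in _)). Qed.

Lemma dict_notin_e : 'e \notin flatten dict.
Proof.
apply/negP => /flattenP[s]; rewrite mem_cat => /orP[] /mapP[x _ ->].
  by rewrite (negPf (cell_str_notin_e _)).
by rewrite (negPf (root_str_notin_e _)).
Qed.

Lemma ne_dict : ne (flatten dict) = 0.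
Proof. by apply/count_memPn/dict_notin_e. Qed.

Lemma ne_hom w : ne (hom w) = size w.
Proof.
elim: w => //= x w IHw; rewrite /hom /= -/(hom w) ne_cat IHw.
by rewrite /block ne_cat /= ne_cat /= ne_una ne_dict.
Qed.

Lemma cut_e w x y : hom w = x ++ 'e :: y -> exists w1 a w2,
  [/\ w = w1 ++ a :: w2, x = hom w1 ++ flatten dict &
      y = una (letter_id a) ++ 'd :: flatten dict ++ hom w2].
Proof.
elim: w x => [|a w IHw] x; first by case: x.
rewrite /hom /= -/(hom w) /block -catA => /cat_eq_cut[[q eq_d]|[[|ch q] ->]] /=.
- by have:= dict_notin_e; rewrite eq_d mem_cat mem_head orbT.
- by case=> <-; exists [::], a, w; rewrite cats0 -catA.
case=> <- /cat_eq_cut[[r eq_r]|[r -> /IHw[w1 [a' [w2 [-> -> ->]]]]]].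
  have: 'e \in una (letter_id a) ++ 'd :: flatten dict by rewrite eq_r mem_cat mem_head orbT.
  by rewrite mem_cat (negPf (una_notin _ _)) //= inE (negPf dict_notin_e).
exists (a :: w1), a', w2; split=> //.
by rewrite /hom /= /block -!catA /= -!catA.
Qed.

(** The part [e a^n d] of a letter has no ['c] and each dictionary string has exactly one, so a ['c]
    reveals the string around it. *)
Lemma cut_c w x y : hom w = x ++ 'c :: y ->
  (exists B n Ds C z t, [/\ (B, n, Ds, C) \in cells, x = z ++ lcode B &
     y = una n ++ lcodes Ds ++ [:: 'd, 'd & rcode C ++ 'd :: t]]) \/
  (exists Ds t, Ds \in roots /\ y = lcodes Ds ++ [:: 'd, 'd, 'd & t]).
Proof.
case/flatten_cut=> s1 [s [s2 [t1 [t2 [eq_s eq_t -> ->]]]]].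
have /mapP[a _ eq_a] : s \in map block w by rewrite eq_s mem_cat mem_head orbT.
have {eq_s}: flatten (dict ++ ('e :: una (letter_id a) ++ [:: 'd]) :: dict) = t1 ++ 'c :: t2.
  by rewrite -eq_t eq_a /block flatten_cat /= -catA.
case/flatten_cut=> r1 [r [r2 [t3 [t4 [eq_r eq_t3 -> ->]]]]].
have: r \in dict ++ ('e :: una (letter_id a) ++ [:: 'd]) :: dict.
  by rewrite eq_r mem_cat mem_head orbT.
have -> : (r \in dict ++ ('e :: una (letter_id a) ++ [:: 'd]) :: dict) =
    (r == 'e :: una (letter_id a) ++ [:: 'd]) || (r \in dict).
  by rewrite mem_cat inE; case: (r \in dict); rewrite ?orbT ?orbF.
have c_r : 'c \in r by rewrite eq_t3 mem_cat mem_head orbT.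
case/orP=> [/eqP r_e|].
  by rewrite r_e inE /= mem_cat (negPf (una_notin _ _)) in c_r.
rewrite mem_cat => /orP[] /mapP[].
  move=> [[[B n] Ds] C] x_cells; rewrite eq_t3 => /esym/uniq_cut[].
  - by rewrite (all_notin (lcode_in _)).
  - by rewrite (all_notin (cell_tail_in _ _ _)).
  move=> <- <-; left; exists B, n, Ds, C; rewrite catA.
  exists (flatten s1 ++ flatten r1), (flatten r2 ++ flatten s2); split=> //.
  by rewrite -!catA /= -!catA.
move=> Ds x_roots; rewrite eq_t3 => /esym/(@uniq_cut _ [::])[] //.
  by rewrite mem_cat negb_or (all_notin (lcodes_in _)).
by move=> _ <-; right; exists Ds; eexists; split=> //; rewrite -!catA.
Qed.

Section Soundness.
Variable w : seq Sigma.
Notation hold := (holds w).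
Notation sat := (sat w).

(** * Soundness of the universal grammar *)

(** [EndCode] cannot tell where the final code begins, so no code is named: a satisfied conjunction
    is followed by code symbols only. [lsem_holds] applies once the surrounding text shows the
    actual code. *)
Definition lsem i j xy := exists z ks y,
  [/\ xy = z ++ 'b :: lrule ks ++ 'b :: y, all (mem code_symbols) y &
      forall k, k \in ks -> sat k i j].

Definition rsem i j xy := exists y ks t,
  [/\ xy = y ++ 'b :: rrule ks ++ 'b :: t, all (mem code_symbols) y &
      forall k, k \in ks -> sat k i j].

Lemma lsem_holds i j z D : lsem i j (z ++ lcode D) -> hold D i j.
Proof. by move=> [z' [ks [y [eq_z y_in]]]]; apply/Holds/(lcode_parse y_in eq_z). Qed.

Lemma rsem_holds i j y s D t : rsem i j y -> y ++ s = rcode D ++ 'd :: t -> hold D i j.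
Proof.
case=> y' [ks [t' [-> y_in ks_sat]]]; rewrite -catA /= -catA /= => eq_y.
exact: (Holds (rcode_parse y_in eq_y)).
Qed.

(** The text [s] after [y] is needed to recognise dictionary text, so [Ds] is supplied where that
    text is known. The initial ['d] separates [y] from a code or unary number before it. *)
Definition checks_sem (Q : nat -> nat -> seq sigma0 -> Prop) (x y : seq sigma0) :=
  (exists y', y = 'd :: y') /\
  forall Ds t s, y ++ s = lcodes Ds ++ [:: 'd, 'd & t] ->
    (forall D, D \in Ds -> hold D 0 (ne x)) /\
    exists2 y', y' ++ s = t & Q (ne x) (ne (x ++ y)) y'.

Definition end_sem (i j : nat) (y : seq sigma0) :=
  exists2 y', y = 'd :: y' & ne y' = 0.

(* Invariants for propositions A(x<y>) with xy a prefix of the image of w.  For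
   EndPair, EndLetter, StartPair and StartLetter the shape of y is recorded, as
   the unary number in y gets its meaning only from the surrounding string. *)
Definition Sem (A : nt0) (x y : seq sigma0) : Prop :=
  let i := ne x in let j := ne (x ++ y) in
  match A with
  | Start => y != [::] /\ (x = [::] -> y = hom w ->
      exists2 Ds, Ds \in roots & forall D, D \in Ds -> hold D 0 (size w))
  | RootChecks => checks_sem end_sem x y
  | Checks => checks_sem rsem x y
  | PrefixCheck => y = [::] /\ lsem 0 i x
  | EndCode => lsem i j (x ++ y)
  | EndRule => exists z ks, x ++ y = z ++ 'b :: lrule ks /\ forall k, k \in ks -> sat k i j
  | EndAtom => forall z k, x ++ y = z ++ '# :: una k -> sat k i j
  | EndPair => exists k y', y = una k ++ y' ++ '# :: una k /\ checks_sem rsem (x ++ una k) y'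
  | EndLetter => exists k y', y = una k ++ 'd :: y' ++ '# :: una k /\ ne y' = 0
  | StartCode => rsem i j y
  | StartRule => exists ks t, y = rrule ks ++ 'b :: t /\ forall k, k \in ks -> sat k i j
  | StartAtom => forall k t, y = una k ++ '# :: t -> sat k i j
  | StartPair => exists k y', y = una k ++ '# :: y' ++ 'c :: una k /\
      lsem i j (x ++ una k ++ '# :: y')
  | StartLetter => exists k y', y = una k ++ '# :: y' ++ 'e :: una k /\ ne y' = 0
  | AnyString => True
  | CodeString => all (mem code_symbols) y
  | NoLetter => ne y = 0
  | UnaryString => exists k, y = una k
  end.

Definition rule_ok r := forall u v, prefix (u ++ v) (hom w) ->
  (forall alpha, alpha \in base_conjuncts r -> @sem_seq _ G0 Sem alpha u v) ->
  (forall gamma, gamma \in extleft_conjuncts r -> @sem_seq _ G0 Sem gamma [::] (u ++ v)) ->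
  Sem (lhs r) u v.

Lemma rule_ok_plain A alpha :
  (forall u v, prefix (u ++ v) (hom w) -> @sem_seq _ G0 Sem alpha u v -> Sem A u v) ->
  rule_ok (plain A alpha).
Proof. by move=> ok u v pre base _; apply: ok pre (base _ _); rewrite mem_head. Qed.

Lemma forall_in_cons (T : eqType) (P : T -> Prop) x s :
  P x -> (forall y, y \in s -> P y) -> forall y, y \in x :: s -> P y.
Proof. by move=> Px Ps y; rewrite inE => /orP[/eqP->|/Ps]. Qed.

Lemma lcodes_dd Ds t : exists y, lcodes Ds ++ [:: 'd, 'd & t] = 'd :: y.
Proof. by case: Ds => [|D Ds]; eexists; reflexivity. Qed.

Lemma checks_sem_cons Q x y1 y : all (mem code_symbols) y1 ->
  lsem 0 (ne (x ++ [:: 'd, 'b & y1])) (x ++ [:: 'd, 'b & y1]) ->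
  checks_sem Q (x ++ [:: 'd, 'b & y1]) y -> checks_sem Q x [:: 'd, 'b & y1 ++ y].
Proof.
move=> y1_in lsem1 [[y' eq_y] IH]; split=> [|[|D Ds] t s]; [by eexists| by []|].
have -> : lcodes (D :: Ds) = lcode D ++ lcodes Ds by [].
case; rewrite -!catA; have [r eq_r] := lcodes_dd Ds t.
move=> eq_str; have eq1 : y1 ++ 'd :: (y' ++ s) = lbody D ++ 'd :: r.
  by rewrite -eq_r -eq_str eq_y.
have [//|//|eq_y1 _ eq2] := span_inj y1_in (lbody_in D) _ _ eq1.
have [|] := IH Ds t s; first by rewrite eq_r eq_y /= eq2.
have neE : ne (x ++ [:: 'd, 'b & y1]) = ne x.
  by rewrite ne_cat /= (ne_codes y1_in) !addn0.
rewrite neE => hold_Ds; rewrite -!catA /= => ex_y'; split=> // D'.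
rewrite inE => /orP[/eqP->|/hold_Ds//].
by rewrite neE eq_y1 in lsem1; apply: lsem_holds lsem1.
Qed.

Lemma checks_sem_nil (Q : nat -> nat -> seq sigma0 -> Prop) x y :
  Q (ne x) (ne (x ++ [:: 'd, 'd & y])) y -> checks_sem Q x [:: 'd, 'd & y].
Proof.
move=> Qy; split=> [|[|D Ds] t s //]; first by eexists.
by case=> <-; split=> //; exists y.
Qed.

Lemma una_rcons k : una k ++ [:: 'a] = 'a :: una k.
Proof. by elim: k => //= k ->. Qed.

Lemma una_span k y m t x z : ~~ pred1 'a x -> ~~ pred1 'a z ->
  una k ++ x :: y = una m ++ z :: t -> [/\ k = m, x = z & y = t].
Proof.
move=> xa za; case/(@span_inj _ (pred1 'a)); rewrite ?una_a // => /(congr1 size).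
by rewrite !size_nseq.
Qed.

Lemma una_span_rev k y m t x z : ~~ pred1 'a x -> ~~ pred1 'a z ->
  y ++ x :: una k = t ++ z :: una m -> [/\ y = t, x = z & k = m].
Proof.
move=> xa za; case/(@span_inj_rev _ (pred1 'a)); rewrite ?una_a // => -> -> /(congr1 size).
by rewrite !size_nseq.
Qed.

(** The ['c] fixes a dictionary string, and the ['d] after its number forces that number to be [k].
    The code before it and the checks after it then supply the premises of [SatPair]. *)
Lemma pair_sat x x' k y s i : hom w = x ++ 'c :: una k ++ y ++ s ->
  lsem i (ne x) x -> ne x' = ne x -> checks_sem rsem x' y -> sat k i (ne (x' ++ y)).
Proof.
move=> eq_w semx ne_x [[y' eq_y] semy].
case: (cut_c eq_w) => [[B [n [Ds [C [z [t [in_cells eq_x eq_str]]]]]]]|[Ds [t [_ eq_str]]]].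
  have [r eq_r] := lcodes_dd Ds (rcode C ++ 'd :: t).
  rewrite eq_y eq_r /= in eq_str; have [//|//|eq_k _ {}eq_str] := una_span _ _ eq_str.
  have [|hold_Ds [y1 eq_y1 sem1]] := semy Ds (rcode C ++ 'd :: t) s.
    by rewrite eq_r eq_y /= eq_str.
  rewrite -ne_x eq_x in semx; rewrite eq_k; apply: (@SatPair w B n Ds C i (ne x')) => //.
    exact: lsem_holds semx.
  exact: rsem_holds sem1 eq_y1.
(* In a root string a third ['d] stands where [rsem] expects a code. *)
have [r eq_r] := lcodes_dd Ds ('d :: t).
rewrite eq_y eq_r /= -['d :: r]/(una 0 ++ _) in eq_str.
have [//|//|_ _ {}eq_str] := una_span _ _ eq_str.
have [|_ [y1 eq_y1 [y2 [ks [t' [eq2 y2_in _]]]]]] := semy Ds ('d :: t) s.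
  by rewrite eq_r eq_y /= eq_str.
by case: y2 y2_in eq2 eq_y1 => [|ch y2] /= => [_|/andP[ch_in _]] -> // [chE]; rewrite chE in ch_in.
Qed.

Lemma letter_sat x k y s : hom w = x ++ 'e :: una k ++ 'd :: y ++ s ->
  sat k (ne x) (ne x).+1.
Proof.
case/cut_e=> w1 [a [w2 [eq_w -> /una_span[] // -> _ _]]].
by rewrite ne_cat ne_hom ne_dict addn0; apply: SatLetter eq_w.
Qed.

Lemma main_rules_ok r : r \in main_rules0 -> rule_ok r.
Proof.
rewrite /main_rules0; move: r.
have seq_checks A Q u v : (forall x y, Sem A x y -> checks_sem Q x y) ->
  @sem_seq _ G0 Sem [:: tm 'd; tm 'b; nt CodeString; nt PrefixCheck; nt A] u v -> checks_sem Q u v.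
  move=> semA /= [v1 [v2 [-> -> [v3 [v4 [-> -> [y1 [v6 [-> y1_in [v7 [v8 [-> [-> lsemz]]]]]]]]]]]]].
  case=> y [v10 [-> /semA sem_y ->]]; rewrite !cats0 in sem_y lsemz *.
  rewrite -?catA /= in sem_y lsemz.
  by apply: checks_sem_cons.
apply: forall_in_cons; first apply: rule_ok_plain => u v pre /=.
  case=> z [v1 [-> _ [v2 [y [-> -> [v3 [v4 [-> [[y0 eq_y] sem_y] ->]]]]]]]];
  split=> [|u0]; [by case: (z) | subst u]; rewrite cats0 /= in sem_y * => eq_w.
  case: (cut_c (esym eq_w)) => [[B [n [Ds [C [z' [t [_ _ eq_v3]]]]]]]|[Ds [t [in_roots eq_v3]]]].
    (* A cell is impossible: a positive number puts ['a] after the ['c] where ['d] is required, and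
       for number 0 the text after the checks begins with ['b] instead of a third ['d]. *)
    case: n eq_v3 => [|n]; last by move=> eq_v3; rewrite eq_v3 in eq_y.
    move=> eq_v3; have [|_ [y' eq_y' [y1 eq_y1 _]]] := sem_y Ds (rcode C ++ 'd :: t) [::].
      by rewrite cats0.
    by rewrite eq_y1 in eq_y'.
  exists Ds => // D D_in; have [|hold_Ds [y' eq_y' [y1 eq_y1 ne_y1]]] := sem_y Ds ('d :: t) [::].
    by rewrite cats0.
  (* No ['e] follows the checks, so they refer to the last position of [w]. *)
  have := hold_Ds D D_in; rewrite -ne_hom -eq_w; congr (hold _ _ _).
  rewrite eq_y1 cats0 in eq_y'; case: eq_y' => eq_t.
  by rewrite eq_v3 -eq_t; nes; rewrite ne_y1 !addn0.
apply: forall_in_cons; first by apply: rule_ok_plain => u v pre; apply: seq_checks.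
apply: forall_in_cons; first apply: rule_ok_plain => u v pre /=.
  case=> v1 [v2 [-> -> [v3 [v4 [-> -> [v5 [v6 [-> -> [v7 [v8 [-> ne_v7 ->]]]]]]]]]]].
  by rewrite cats0; apply: checks_sem_nil; exists v7.
apply: forall_in_cons; first by apply: rule_ok_plain => u v pre; apply: seq_checks.
apply: forall_in_cons; first apply: rule_ok_plain => u v pre /=.
  case=> v1 [v2 [-> -> [v3 [v4 [-> -> [v5 [v6 [-> sem5 ->]]]]]]]].
  rewrite cats0; apply: checks_sem_nil; move: sem5; rewrite /Sem -?catA.
  by congr rsem; nes.
apply: forall_in_cons.
  move=> u v _ base ext; have /= eq_v := base [::] (mem_head _ _).
  have /= [v1 [v2 [eq_u sem1 eq_v2]]] := ext _ (mem_head _ _).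
  by rewrite eq_v eq_v2 !cats0 in eq_u *; rewrite eq_u.
apply: forall_in_cons; first apply: rule_ok_plain => u v pre /=.
  case=> v1 [v2 [-> [z [ks [eq_z sat_ks]]] [v3 [v4 [-> -> [y [v5 [-> y_in ->]]]]]]]].
  exists z, ks, y; split=> //; first by rewrite cats0 catA eq_z -catA.
  move=> k /sat_ks; congr sat; move: (ne_codes y_in); rewrite cats0; nes.
apply: forall_in_cons; first apply: rule_ok_plain => u v pre /=.
  case=> v1 [v2 [-> _ [v3 [v4 [-> -> ->]]]]]; exists (u ++ v1), [::].
  by rewrite -catA.
apply: forall_in_cons.
  move=> u v pre base _; have /= sem1 := base _ (mem_head _ _).
  have /= [|v' [v0 [eq_v' sem2 eq_v0]]] := base [:: nt EndAtom] _.
    by rewrite !inE eqxx orbT.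
  rewrite eq_v0 cats0 in eq_v'; subst v' v0.
  case: sem1 sem2 => v1 [v2 [-> [z [ks [eq_z sat_ks]]] [v3 [v4 [-> -> [v5 [v6 [-> [k ->] ->]]]]]]]].
  rewrite cats0 => sem2; exists z, (rcons ks k); split.
    by rewrite catA eq_z -?catA /lrule map_rcons flatten_rcons.
  move=> m; rewrite mem_rcons inE => /orP[/eqP->|].
    by apply: (sem2 (u ++ v1)); rewrite -catA.
  by move/sat_ks; congr sat; nes.
apply: forall_in_cons; first apply: rule_ok_plain => u v pre /=.
  case=> y1 [v1 [eq_v sem1 [v2 [v3 [eq_v1 eq_v2 [v4 [v5 [eq_v3 [k [y [eq_v4 semy]]] eq_v5]]]]]]]].
  subst v1 v2 v3 v5; rewrite !cats0 in eq_v; subst v4 v.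
  move=> z k'; set v := (v in u ++ v).
  have eq_v : u ++ v = (u ++ y1 ++ 'c :: una k ++ y) ++ '# :: una k.
    by rewrite /v; cats.
  rewrite {1}eq_v => /una_span_rev[] // _ _ <-.
  have [s eq_w] := prefixP pre.
  have := @pair_sat (u ++ y1) ((u ++ y1) ++ 'c :: una k) k y ('# :: una k ++ s) (ne u).
  rewrite -?catA /= in sem1 semy *.
  have -> : ne (u ++ v) = ne (u ++ y1 ++ 'c :: una k ++ y) by rewrite eq_v; nes.
  apply=> //; last by nes.
  by rewrite eq_w /v; cats.
apply: forall_in_cons; first apply: rule_ok_plain => u v pre /=.
  case=> y1 [v1 [eq_v ne1 [v2 [v3 [eq_v1 eq_v2 [v4 [v5 [eq_v3 [k [y [eq_v4 ne_y]]] eq_v5]]]]]]]].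
  subst v1 v2 v3 v5; rewrite !cats0 in eq_v; subst v4 v.
  move=> z k'; set v := (v in u ++ v).
  have eq_v : u ++ v = (u ++ y1 ++ 'e :: una k ++ 'd :: y) ++ '# :: una k.
    by rewrite /v; cats.
  rewrite {1}eq_v => /una_span_rev[] // _ _ <-.
  have [s eq_w] := prefixP pre.
  have := @letter_sat (u ++ y1) k y ('# :: una k ++ s).
  rewrite eq_v -?catA /= eq_w /v -?catA /= -?catA /= => /(_ erefl); congr sat; nes.
apply: forall_in_cons; first apply: rule_ok_plain => u v pre /=.
  case=> v1 [v2 [-> -> [y [v4 [-> [k [y' [-> sem_y]]] [v5 [v6 [-> -> ->]]]]]]]].
  exists k.+1, y'; rewrite -?catA /= in sem_y *; split=> //.
  by cats; rewrite una_rcons.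
apply: forall_in_cons; first apply: rule_ok_plain => u v pre /=.
  case=> v1 [v2 [-> sem_v1 [v3 [v4 [-> -> ->]]]]].
  by exists 0, v1; rewrite /= !cats0.
apply: forall_in_cons; first apply: rule_ok_plain => u v pre /=.
  case=> v1 [v2 [-> -> [y [v4 [-> [k [y' [-> sem_y]]] [v5 [v6 [-> -> ->]]]]]]]].
  exists k.+1, y'; split=> //.
  by cats; rewrite una_rcons.
apply: forall_in_cons; first apply: rule_ok_plain => u v pre /=.
  case=> v1 [v2 [-> -> [v3 [v4 [-> ne_v3 [v5 [v6 [-> -> ->]]]]]]]].
  by exists 0, v3.
apply: forall_in_cons; first apply: rule_ok_plain => u v pre /=.
  case=> v1 [v2 [-> v1_in [v3 [v4 [-> -> [v5 [v6 [-> [ks [t [-> sat_ks]]] ->]]]]]]]].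
  exists v1, ks, t; rewrite cats0; split=> // k /sat_ks; congr sat.
    by nes; rewrite (ne_codes v1_in) !addn0.
  by nes.
apply: forall_in_cons; first apply: rule_ok_plain => u v pre /=.
  case=> v1 [v2 [-> -> [v3 [v4 [-> _ ->]]]]].
  by exists [::], v3; rewrite cats0.
apply: forall_in_cons.
  move=> u v pre base _; have /= sem1 := base _ (mem_head _ _).
  have /= [|v' [v0 [eq_v' sem2 eq_v0]]] := base [:: nt StartAtom] _.
    by rewrite !inE eqxx orbT.
  rewrite eq_v0 cats0 in eq_v'; subst v' v0.
  case: sem1 sem2 => v1 [v2 [-> [k ->] [v3 [v4 [-> -> [v5 [v6 [-> [ks [t [-> sat_ks]]] ->]]]]]]]].
  rewrite cats0 => sem2; exists (k :: ks), t; split.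
    by rewrite /rrule /= -?catA.
  move=> m; rewrite inE => /orP[/eqP->|]; first exact: (sem2 _ (rrule ks ++ 'b :: t)).
  by move/sat_ks; congr sat; nes.
apply: forall_in_cons; first apply: rule_ok_plain => u v pre /=.
  case=> v1 [v2 [eq_v [k [y [eq_v1 sem_y]]] [v3 [v4 [eq_v2 sem_v3 eq_v4]]]]].
  subst v1 v2 v4; rewrite cats0 in eq_v; subst v => k' t.
  rewrite -?catA /= => /una_span[] // <- _ _.
  have [s eq_w] := prefixP pre.
  have := @pair_sat (u ++ una k ++ '# :: y) (u ++ una k ++ '# :: y ++ 'c :: una k) k v3 s (ne u).
  rewrite -?catA /= -?catA /=; apply=> //.
  - by rewrite eq_w; cats.
  - by move: sem_y; congr lsem; nes.
  by nes.
apply: forall_in_cons; first apply: rule_ok_plain => u v pre /=.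
  case=> v1 [v2 [eq_v [k [y [eq_v1 ne_y]]] [v3 [v4 [eq_v2 eq_v3 [v5 [v6 [eq_v4 ne_v5 eq_v6]]]]]]]].
  subst v1 v2 v3 v4 v6; rewrite cats0 in eq_v; subst v => k' t.
  rewrite -?catA /= => /una_span[] // <- _ _.
  have [s eq_w] := prefixP pre.
  have := @letter_sat (u ++ una k ++ '# :: y) k v5 s.
  rewrite eq_w -?catA /= -?catA /= => /(_ erefl); congr sat; nes.
apply: forall_in_cons; first apply: rule_ok_plain => u v pre /=.
  case=> v1 [v2 [-> -> [y [v4 [-> [k [y' [-> sem_y]]] [v5 [v6 [-> -> ->]]]]]]]].
  exists k.+1, y'; split; first by cats; rewrite una_rcons.
  move: sem_y; rewrite -?catA /=; congr lsem; nes.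
apply: forall_in_cons; first apply: rule_ok_plain => u v pre /=.
  case=> v1 [v2 [-> -> [y [v4 [-> sem_y [v5 [v6 [-> -> ->]]]]]]]].
  exists 0, y; split=> //; move: sem_y; rewrite -?catA /=; congr lsem; nes.
apply: forall_in_cons; first apply: rule_ok_plain => u v pre /=.
  case=> v1 [v2 [-> -> [y [v4 [-> [k [y' [-> sem_y]]] [v5 [v6 [-> -> ->]]]]]]]].
  by exists k.+1, y'; split=> //; cats; rewrite una_rcons.
apply: forall_in_cons => //; apply: rule_ok_plain => u v pre /=.
case=> v1 [v2 [-> -> [y [v4 [-> ne_y [v5 [v6 [-> -> ->]]]]]]]].
by exists 0, y.
Qed.

Lemma rules0_ok r : r \in rules0 -> rule_ok r.
Proof.
have star (P : pred sigma0) A l : (forall x, x \in l -> P x) ->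
    (forall u v, all P v <-> Sem A u v) -> r \in star_rules A l -> rule_ok r.
  move=> lP semA; rewrite inE => /orP[/eqP->|/mapP[x x_l ->]] u v _ base _ /=.
    by apply/semA; have /= -> := base _ (mem_head _ _).
  have /= [v1 [v2 [-> -> [v3 [v4 [-> /semA Pv3 ->]]]]]] := base _ (mem_head _ _).
  by apply/semA; rewrite /= lP // cats0.
rewrite !mem_cat; case/orP; first exact: main_rules_ok.
case/or4P.
- by apply: (star predT) => // u v; split=> // _; apply/allP.
- by apply: (star (mem code_symbols)).
- apply: (star (predC1 'e)); first by case.
  move=> u v; split=> [Pv|ne_v]; first by apply: count_all0 Pv _.
  by apply/allP=> x; apply: contraTneq => /= ->; apply/count_memPn.
apply: (star (pred1 'a)) => [x|u v]; first by rewrite inE.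
split=> [/all_pred1P->|[k ->]]; last exact: una_a.
by exists (size v).
Qed.

Lemma hom_sound : language G0 (hom w) -> w != [::] /\
  exists2 Ds, Ds \in roots & forall D, D \in Ds -> hold D 0 (size w).
Proof.
move=> d_w; have [sem _] := @derives_sem _ G0 (hom w) Sem (fun r u v r_in pre base _ =>
  rules0_ok r_in pre base).
have [w_neq0 ex_Ds] := sem _ _ _ d_w (prefix_refl _).
by split; [case: (w) w_neq0 | apply: ex_Ds].
Qed.

End Soundness.

(** * Completeness of the universal grammar *)

Section Completeness.
Variable w : seq Sigma.
Notation hold := (holds w).
Notation sat := (sat w).
Notation drv A := (@derives _ G0 (inr A)).

(* Nonempty conjunctions make the factors of satisfied atoms nonempty, so that
   the splitting position lies strictly inside, where a full copy of the
   dictionary is available. *)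
Hypothesis cells_nonempty : forall B n Ds C, (B, n, Ds, C) \in cells ->
  [::] \notin B /\ [::] \notin C.

Lemma holds_sat_lt :
  (forall D i j, hold D i j -> [::] \notin D -> i < j) /\
  (forall k i j, sat k i j -> i < j).
Proof.
apply: holds_combined => [D ks i j ks_D _ IH D0|w1 x w2 //|].
  case: ks ks_D IH => [|k ks] ks_D IH; first by rewrite ks_D in D0.
  by apply: (IH k); rewrite mem_head.
move=> B n Ds C i m j /cells_nonempty[B0 C0] _ /(_ B0) im _ /(_ C0) mj _ _.
exact: ltn_trans im mj.
Qed.

Lemma hom_split m : 0 < m -> m < size w -> exists p q r,
  [/\ hom w = p ++ 'e :: q ++ flatten dict ++ 'e :: r, ne p = m.-1 & ne q = 0].
Proof.
move=> m_gt0 lt_mw.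
have: 1 < size (drop m.-1 w) by rewrite size_drop; lia.
have: size (take m.-1 w) = m.-1 by rewrite size_take; case: ifP; lia.
rewrite -{3}(cat_take_drop m.-1 w); case: (drop _ _) => [|a [|a' w2]] // sz _.
(* The displayed copy of the dictionary opens the block of [a'], the letter after position [m]; the
   ['e] to its left is that of [a]. *)
exists (hom (take m.-1 w) ++ flatten dict), (una (letter_id a) ++ 'd :: flatten dict).
exists (una (letter_id a') ++ 'd :: flatten dict ++ hom w2); split.
- by rewrite hom_cat /hom /= /block; cats.
- by rewrite ne_cat ne_hom ne_dict addn0.
by nes; rewrite ne_dict.
Qed.

(** By the two strict inequalities both ['e] around position [m] lie in [y], hence so does the
    dictionary between them. *)
Lemma find_dict x y s m : hom w = x ++ y ++ s -> ne x < m -> m < ne (x ++ y) ->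
  exists y1 y2, y = y1 ++ flatten dict ++ y2 /\ ne (x ++ y1) = m.
Proof.
move=> eq_w lt_xm lt_my; have le_yw : ne (x ++ y) <= size w.
  by rewrite -ne_hom eq_w catA [X in _ <= X]ne_cat leq_addr.
have [||p [q [r [eq_w' ne_p ne_q]]]] := @hom_split m.
- exact: leq_ltn_trans lt_xm.
- exact: leq_trans lt_my le_yw.
rewrite eq_w' in eq_w; have [|t eq_p eq_y] := ne_cut_le eq_w; first by rewrite ne_p; lia.
have ne_t : ne x + ne t = m.-1 by rewrite -ne_p eq_p ne_cat.
have {}eq_y : (t ++ 'e :: q ++ flatten dict) ++ 'e :: r = y ++ s by rewrite eq_y; cats.
have [|y' -> _] := ne_cut_gt eq_y.
  by move: lt_my; rewrite ne_cat; nes; rewrite ne_dict ne_q; lia.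
exists (t ++ 'e :: q), ('e :: y'); split; first by cats.
by nes; rewrite ne_q; lia.
Qed.

Lemma find_cell x y s m B n Ds C : (B, n, Ds, C) \in cells ->
  hom w = x ++ y ++ s -> ne x < m -> m < ne (x ++ y) ->
  exists p q, ne (x ++ p) = m /\
    y = p ++ lcode B ++ 'c :: una n ++ lcodes Ds ++ [:: 'd, 'd & rcode C ++ 'd :: q].
Proof.
move=> in_cells /find_dict find /find{find}/[apply] -[y1 [y2 [-> ne_y1]]].
have [|x1 [x2 eq_d]] := @flatten_mem _ dict (cell_str (B, n, Ds, C)).
  by rewrite mem_cat map_f.
have ne_x1 : ne x1 = 0 by have := ne_dict; rewrite eq_d ne_cat; lia.
exists (y1 ++ x1), (x2 ++ y2); split; first by rewrite catA ne_cat ne_y1 ne_x1 addn0.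
by rewrite eq_d; cats.
Qed.

(** The ['#] after [y] occurs neither in a unary number nor as the ['d] behind it, so [y] cannot
    stop short of that ['d]. *)
Lemma find_letter x y s w1 a w2 : w = w1 ++ a :: w2 -> hom w = x ++ y ++ '# :: s ->
  ne x = size w1 -> ne (x ++ y) = (size w1).+1 ->
  exists p q, [/\ y = p ++ 'e :: una (letter_id a) ++ 'd :: q, ne p = 0 & ne q = 0].
Proof.
move=> -> eq_w ne_x ne_y; have {}eq_w : (hom w1 ++ flatten dict) ++
    'e :: una (letter_id a) ++ 'd :: flatten dict ++ hom w2 = x ++ y ++ '# :: s.
  by rewrite -eq_w hom_cat /hom /= /block; cats.
have [|p eq_p eq_y] := ne_cut_le eq_w.
  by rewrite ne_cat ne_hom ne_dict ne_x; lia.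
have ne_p : ne p = 0.
  by move/(congr1 ne): eq_p; rewrite !ne_cat ne_hom ne_dict; lia.
have [|q eq_q] := ne_cut_gt (esym eq_y).
  by move: ne_y; rewrite ne_cat; lia.
case/cat_eq_cut=> [[r eq_r]|[r eq_r]].
  have: '# \in una (letter_id a) by rewrite eq_r mem_cat mem_head orbT.
  by rewrite (negPf (una_notin _ _)).
case: r eq_r => // ch r eq_r [chE _]; exists p, r; rewrite eq_q eq_r -chE; split=> //.
by move: ne_y; rewrite eq_q eq_r ne_cat; nes.
Qed.

(** Every occurrence in the image has to be covered, since codes are read in whichever dictionary
    copy a split picks. In the next three definitions the ['#] after [y] is the mark needed by
    [find_letter]. *)
Definition lcode_complete D i j := forall x y s, hom w = x ++ y ++ lcode D ++ s ->
  ne x = i -> ne (x ++ y) = j -> drv EndCode x (y ++ lcode D).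

Definition rcode_complete D i j := forall x y s, hom w = x ++ rcode D ++ y ++ '# :: s ->
  ne x = i -> ne (x ++ y) = j -> drv StartCode x (rcode D ++ y).

Definition latom_complete k i j := forall x y s, hom w = x ++ y ++ '# :: una k ++ s ->
  ne x = i -> ne (x ++ y) = j -> drv EndAtom x (y ++ '# :: una k).

Definition ratom_complete k i j := forall x y s, hom w = x ++ una k ++ '# :: y ++ '# :: s ->
  ne x = i -> ne (x ++ y) = j -> drv StartAtom x (una k ++ '# :: y).

Lemma drv_wrap A u y : plain A [:: tm 'a; nt A; tm 'a] \in rules0 ->
  drv A (u ++ [:: 'a]) y -> drv A u ('a :: y ++ [:: 'a]).
Proof.
move=> A_in dA; apply: (derives_plain A_in); apply/derives_term/(derives_cat erefl dA).
exact/derives_term/derives_nil.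
Qed.

Lemma drv_EndPair u v k : drv Checks (u ++ una k) v -> drv EndPair u (una k ++ v ++ '# :: una k).
Proof.
elim: k u => [|k IHk] u dv.
  apply: (@derives_plain EndPair [:: nt Checks; tm '#]) => //.
  by rewrite cats0 in dv; apply/(derives_cat _ dv)/derives_term/derives_nil.
have -> : una k.+1 ++ v ++ '# :: una k.+1 =
    'a :: (una k ++ v ++ '# :: una k) ++ [:: 'a].
  by rewrite /= -una_rcons; cats.
by apply: drv_wrap => //; apply: IHk; rewrite -catA.
Qed.

Lemma drv_StartPair u v k : drv EndCode (u ++ una k ++ [:: '#]) v ->
  drv StartPair u (una k ++ '# :: v ++ 'c :: una k).
Proof.
elim: k u => [|k IHk] u dv.
  apply: (@derives_plain StartPair [:: tm '#; nt EndCode; tm 'c]) => //; apply: derives_term.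
  exact/(derives_cat _ dv)/derives_term/derives_nil.
have -> : una k.+1 ++ '# :: v ++ 'c :: una k.+1 =
    'a :: (una k ++ '# :: v ++ 'c :: una k) ++ [:: 'a].
  by rewrite /= -una_rcons; cats.
by apply: drv_wrap => //; apply: IHk; rewrite -catA.
Qed.

Lemma drv_EndLetter u v k : 'e \notin v -> drv EndLetter u (una k ++ 'd :: v ++ '# :: una k).
Proof.
move=> ev; elim: k u => [|k IHk] u.
  apply: (@derives_plain EndLetter [:: tm 'd; nt NoLetter; tm '#]) => //; apply: derives_term.
  exact/(derives_cat _ (derives_NoLetter _ ev))/derives_term/derives_nil.
have -> : una k.+1 ++ 'd :: v ++ '# :: una k.+1 =
    'a :: (una k ++ 'd :: v ++ '# :: una k) ++ [:: 'a].
  by rewrite /= -una_rcons; cats.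
exact: drv_wrap.
Qed.

Lemma drv_StartLetter u v k : 'e \notin v -> drv StartLetter u (una k ++ '# :: v ++ 'e :: una k).
Proof.
move=> ev; elim: k u => [|k IHk] u.
  apply: (@derives_plain StartLetter [:: tm '#; nt NoLetter; tm 'e]) => //; apply: derives_term.
  exact/(derives_cat _ (derives_NoLetter _ ev))/derives_term/derives_nil.
have -> : una k.+1 ++ '# :: v ++ 'e :: una k.+1 =
    'a :: (una k ++ '# :: v ++ 'e :: una k) ++ [:: 'a].
  by rewrite /= -una_rcons; cats.
exact: drv_wrap.
Qed.

Lemma drv_checks A x Ds t s m :
  plain A [:: tm 'd; tm 'b; nt CodeString; nt PrefixCheck; nt A] \in rules0 ->
  (forall D, D \in Ds -> lcode_complete D 0 m) -> hom w = x ++ lcodes Ds ++ t ++ s ->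
  ne x = m -> drv A (x ++ lcodes Ds) t -> drv A x (lcodes Ds ++ t).
Proof.
move=> A_in; elim: Ds x => [|D Ds IHDs] x compD eq_w ne_x dA.
  by rewrite cats0 in dA.
have eD : lcodes (D :: Ds) = lcode D ++ lcodes Ds by [].
have eDt : lcodes (D :: Ds) ++ t = [:: 'd, 'b & lbody D ++ (lcodes Ds ++ t)] by rewrite eD; cats.
rewrite eD in eq_w; rewrite eDt; apply: (derives_plain A_in); apply/derives_term/derives_term.
apply: (derives_cat (v1 := lbody D) (v2 := lcodes Ds ++ t)) => //.
  by apply: derives_CodeString => ch; apply: (allP (lbody_in D)).
have eq_u : ((x ++ [:: 'd]) ++ [:: 'b]) ++ lbody D = x ++ lcode D by cats.
rewrite eq_u; apply: (@derives_cat _ G0 _ _ _ _ [::] _ erefl).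
  apply: (@derives_rule _ G0 (Rule PrefixCheck [:: [::]] [::] [:: [:: nt EndCode]])) => // alpha.
    by rewrite inE => /eqP->; apply: derives_nil.
  rewrite inE => /eqP->; apply/derives_seq1; rewrite cats0.
  (* The extended left context is the whole prefix up to this code, so the code is read from
     position 0 to [m]. *)
  apply: (compD D (mem_head _ _) [::] x (lcodes Ds ++ t ++ s)) => //.
  by rewrite eq_w; cats.
rewrite cats0; apply/derives_seq1; apply: IHDs => //.
- by move=> D' D'_in; apply: compD; rewrite inE D'_in orbT.
- by rewrite eq_w; cats.
- by rewrite ne_cat ne_lcode addn0.
by rewrite -catA -eD.
Qed.

Lemma drv_NoLetter u v : ne v = 0 -> drv NoLetter u v.
Proof. by move=> /count_memPn; apply: derives_NoLetter. Qed.

Lemma lrule_rcons ks k : lrule (rcons ks k) = lrule ks ++ '# :: una k.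
Proof. by rewrite /lrule map_rcons flatten_rcons. Qed.

Lemma lbody_cat D1 D2 : lbody (D1 ++ D2) = lbody D1 ++ lbody D2.
Proof. by rewrite /lbody map_cat flatten_cat. Qed.

Lemma rbody_cat D1 D2 : rbody (D1 ++ D2) = rbody D1 ++ rbody D2.
Proof. by rewrite /rbody map_cat flatten_cat. Qed.

Lemma drv_EndRule ks i j x y s : (forall k, k \in ks -> latom_complete k i j) ->
  hom w = x ++ y ++ 'b :: lrule ks ++ s -> ne x = i -> ne (x ++ y) = j ->
  drv EndRule x (y ++ 'b :: lrule ks).
Proof.
move=> + + ne_x ne_y; elim/last_ind: ks s => [|ks k IHks] s comp eq_w.
  apply: (@derives_plain EndRule [:: nt AnyString; tm 'b]) => //.
  exact/(derives_cat erefl (derives_AnyString _ _))/derives_term/derives_nil.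
rewrite lrule_rcons in eq_w *.
have -> : y ++ 'b :: lrule ks ++ '# :: una k = (y ++ 'b :: lrule ks) ++ '# :: una k by cats.
apply: (@derives_and EndRule [:: nt EndRule; tm '#; nt UnaryString] [:: nt EndAtom]) => //.
  apply: (derives_cat erefl).
    apply: (IHks ('# :: una k ++ s)) => [k' k'_in|].
      by apply: comp; rewrite mem_rcons inE k'_in orbT.
    by rewrite eq_w; cats.
  by apply/derives_term/derives_seq1/derives_UnaryString.
apply/derives_seq1; apply: (comp k _ _ _ s) => //; first by rewrite mem_rcons mem_head.
  by rewrite eq_w; cats.
by rewrite -ne_y; nes.
Qed.

Lemma drv_StartRule ks i j x y s : (forall k, k \in ks -> ratom_complete k i j) ->
  hom w = x ++ rrule ks ++ 'b :: y ++ '# :: s -> ne x = i -> ne (x ++ y) = j ->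
  drv StartRule x (rrule ks ++ 'b :: y).
Proof.
elim: ks x => [|k ks IHks] x comp eq_w ne_x ne_y.
  apply: (@derives_plain StartRule [:: tm 'b; nt AnyString]) => //.
  exact/derives_term/derives_seq1/derives_AnyString.
have eq_r : rrule (k :: ks) = una k ++ '# :: rrule ks by rewrite /rrule /= -catA.
rewrite eq_r in eq_w.
have -> : rrule (k :: ks) ++ 'b :: y = una k ++ '# :: (rrule ks ++ 'b :: y) by rewrite eq_r; cats.
apply: (@derives_and StartRule [:: nt UnaryString; tm '#; nt StartRule] [:: nt StartAtom]) => //.
  apply: (derives_cat (v1 := una k) (v2 := '# :: (rrule ks ++ 'b :: y))) => //.
    exact: derives_UnaryString.
  apply/derives_term/derives_seq1.
  apply: IHks => [k' k'_in|||]; first by apply: comp; rewrite inE k'_in orbT.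
  - by rewrite eq_w; cats.
  - by rewrite -ne_x; nes.
  by rewrite -ne_y; nes.
apply/derives_seq1; apply: (comp k _ _ _ s) => //; first by rewrite mem_head.
  by rewrite eq_w; cats.
by rewrite -ne_y; nes.
Qed.

Lemma holds_complete (D : code) ks i j : ks \in D -> (forall k, k \in ks -> latom_complete k i j) ->
  (forall k, k \in ks -> ratom_complete k i j) -> lcode_complete D i j /\ rcode_complete D i j.
Proof.
case/splitPr: D / => D1 D2 compl compr; split=> x y s eq_w ne_x ne_y.
  have [u eq_u] := flatten_rcons_last lrule D1 'b.
  have eq_D : lcode (D1 ++ ks :: D2) = 'd :: (u ++ [:: 'b]) ++ lrule ks ++ 'b :: lbody D2.
    by rewrite -eq_u /lcode lbody_cat /lbody /=; cats.
  have u_in : ne u = 0.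
    have := ne_lcode D1; rewrite /lcode /lbody eq_u; nes.
  rewrite eq_D in eq_w *.
  have -> : y ++ 'd :: (u ++ [:: 'b]) ++ lrule ks ++ 'b :: lbody D2 =
    ((y ++ 'd :: u) ++ 'b :: lrule ks) ++ 'b :: lbody D2 by cats.
  apply: (@derives_plain EndCode [:: nt EndRule; tm 'b; nt CodeString]) => //.
  apply: (derives_cat erefl); last first.
    apply/derives_term/derives_seq1/derives_CodeString => ch.
    exact: (allP (lbody_in D2)).
  apply: (drv_EndRule (s := 'b :: lbody D2 ++ s) compl) => //.
    by rewrite eq_w; cats.
  by rewrite -ne_y; nes.
have [u eq_u] := flatten_rcons_last rrule D1 'b.
have eq_D : rcode (D1 ++ ks :: D2) = (u ++ [:: 'b]) ++ rrule ks ++ 'b :: rbody D2.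
  by rewrite -eq_u /rcode rbody_cat /rbody /=; cats.
have u_in : all (mem code_symbols) u.
  have : all (mem code_symbols) (rcode D1) := rbody_in D1.
  by rewrite /rcode /rbody eq_u all_cat => /andP[].
rewrite eq_D in eq_w *.
have -> : ((u ++ [:: 'b]) ++ rrule ks ++ 'b :: rbody D2) ++ y =
  u ++ 'b :: (rrule ks ++ 'b :: rbody D2 ++ y) by cats.
apply: (@derives_plain StartCode [:: nt CodeString; tm 'b; nt StartRule]) => //.
apply: (derives_cat erefl); first by apply: derives_CodeString => ch; apply: (allP u_in).
have ne_u := ne_codes u_in.
apply/derives_term/derives_seq1/(drv_StartRule (s := s) compr).
- by rewrite eq_w; cats.
- by rewrite -ne_x; nes.
by rewrite -ne_y; nes.
Qed.

Lemma letter_complete w1 a w2 : w = w1 ++ a :: w2 ->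
  latom_complete (letter_id a) (size w1) (size w1).+1 /\
  ratom_complete (letter_id a) (size w1) (size w1).+1.
Proof.
move=> eq_w1; split=> x y s eq_w ne_x ne_y.
  have [p [q [-> ne_p ne_q]]] := find_letter eq_w1 eq_w ne_x ne_y.
  have -> : (p ++ 'e :: una (letter_id a) ++ 'd :: q) ++ '# :: una (letter_id a) =
    p ++ 'e :: (una (letter_id a) ++ 'd :: q ++ '# :: una (letter_id a)) by cats.
  apply: (@derives_plain EndAtom [:: nt NoLetter; tm 'e; nt EndLetter]) => //.
  apply: (derives_cat erefl (drv_NoLetter _ ne_p)); apply/derives_term/derives_seq1/drv_EndLetter.
  exact/count_memPn.
have eq_w' : hom w = (x ++ una (letter_id a) ++ [:: '#]) ++ y ++ '# :: s by rewrite eq_w; cats.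
have [||p [q [-> ne_p ne_q]]] := find_letter eq_w1 eq_w'.
- by rewrite -ne_x; nes.
- by rewrite -ne_y; nes.
have -> : una (letter_id a) ++ '# :: p ++ 'e :: una (letter_id a) ++ 'd :: q =
  (una (letter_id a) ++ '# :: p ++ 'e :: una (letter_id a)) ++ 'd :: q by cats.
apply: (@derives_plain StartAtom [:: nt StartLetter; tm 'd; nt NoLetter]) => //.
apply: (derives_cat erefl); first by apply/drv_StartLetter/count_memPn.
exact/derives_term/derives_seq1/drv_NoLetter.
Qed.

(** As [m] lies strictly inside, [find_cell] supplies this cell there: [B] is read on its left, [C]
    on its right, [Ds] in between, and its number matches the one outside. *)
Lemma pair_complete B n Ds C i m j : (B, n, Ds, C) \in cells -> i < m -> m < j ->
  lcode_complete B i m -> rcode_complete C m j -> (forall D, D \in Ds -> lcode_complete D 0 m) ->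
  latom_complete n i j /\ ratom_complete n i j.
Proof.
move=> in_cells lt_im lt_mj compB compC compDs.
have drvV x q s : hom w = x ++ lcodes Ds ++ [:: 'd, 'd & rcode C ++ 'd :: q] ++ '# :: s ->
    ne x = m -> ne (x ++ q) = j -> drv Checks x (lcodes Ds ++ [:: 'd, 'd & rcode C ++ 'd :: q]).
  move=> eq_w ne_x ne_q; apply: (@drv_checks _ _ _ _ ('# :: s) m) => //.
  apply: (@derives_plain Checks [:: tm 'd; tm 'd; nt StartCode]) => //.
  apply/derives_term/derives_term/derives_seq1/(compC _ _ s).
  - by rewrite eq_w; cats.
  - by rewrite -ne_x; nes.
  by rewrite -ne_q; nes.
split=> x y s eq_w ne_x ne_y.
  have [||p [q [ne_p eq_y]]] := @find_cell x y ('# :: una n ++ s) m _ _ _ _ in_cells eq_w.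
  - by rewrite ne_x.
  - by rewrite ne_y.
  set V := lcodes Ds ++ [:: 'd, 'd & rcode C ++ 'd :: q].
  have -> : y ++ '# :: una n = (p ++ lcode B) ++ 'c :: (una n ++ V ++ '# :: una n).
    by rewrite eq_y /V; cats.
  apply: (@derives_plain EndAtom [:: nt EndCode; tm 'c; nt EndPair]) => //.
  apply: (derives_cat (v1 := p ++ lcode B)) => //.
    apply: (compB _ _ ('c :: (una n ++ V ++ '# :: una n) ++ s)) => //.
    by rewrite eq_w eq_y /V; cats.
  apply/derives_term/derives_seq1/drv_EndPair/(drvV _ _ (una n ++ s)).
  - by rewrite eq_w eq_y; cats.
  - by rewrite -ne_p; nes.
  by rewrite -ne_y eq_y; nes.
have {}eq_w : hom w = (x ++ una n ++ [:: '#]) ++ y ++ '# :: s by rewrite eq_w; cats.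
have [||p [q [ne_p eq_y]]] := @find_cell _ y ('# :: s) m _ _ _ _ in_cells eq_w.
- by move: lt_im; rewrite -ne_x; nes.
- by move: lt_mj; rewrite -ne_y; nes.
set V := lcodes Ds ++ [:: 'd, 'd & rcode C ++ 'd :: q].
have -> : una n ++ '# :: y = (una n ++ '# :: (p ++ lcode B) ++ 'c :: una n) ++ V.
  by rewrite eq_y /V; cats.
apply: (@derives_plain StartAtom [:: nt StartPair; nt Checks]) => //.
apply: (derives_cat erefl).
  apply: drv_StartPair; apply: (compB _ _ ('c :: (una n ++ V) ++ '# :: s)) => //.
  - by rewrite eq_w eq_y /V; cats.
  by rewrite -ne_x; nes.
apply/derives_seq1/(drvV _ _ s).
- by rewrite eq_w eq_y; cats.
- by rewrite -ne_p; nes.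
by rewrite -ne_y eq_y; nes.
Qed.

Lemma holds_sat_complete :
  (forall D i j, hold D i j -> lcode_complete D i j /\ rcode_complete D i j) /\
  (forall k i j, sat k i j -> latom_complete k i j /\ ratom_complete k i j).
Proof.
have [hold_lt _] := holds_sat_lt.
apply: holds_combined => [D ks i j ks_D _ IH|w1 a w2|B n Ds C i m j in_cells].
- by apply: (holds_complete ks_D) => k /IH[].
- exact: letter_complete.
have [B0 C0] := cells_nonempty in_cells.
move=> holdB [compB _] holdC [_ compC] _ compDs.
apply: (pair_complete in_cells (hold_lt _ _ _ holdB B0) (hold_lt _ _ _ holdC C0)) => //.
by move=> D /compDs[].
Qed.

Lemma hom_complete Ds : w != [::] -> Ds \in roots ->
  (forall D, D \in Ds -> hold D 0 (size w)) -> language G0 (hom w).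
Proof.
move=> w_neq0 Ds_in hold_Ds.
have [w1 [a eq_w]] : exists w1 a, w = rcons w1 a.
  by case/lastP: w w_neq0 => // w1 a _; exists w1, a.
have [|p [q eq_d]] := @flatten_mem _ dict (root_str Ds).
  by rewrite mem_cat map_f ?orbT.
have ne_pq : ne p = 0 /\ ne q = 0 by have:= ne_dict; rewrite eq_d; nes.
(* The root string is taken from the copy of the dictionary that ends the image, so its checks refer
   to all of [w]. *)
have eq_h : hom w = (hom w1 ++ flatten dict ++ 'e :: una (letter_id a) ++ 'd :: p) ++
    'c :: (lcodes Ds ++ [:: 'd, 'd, 'd & q]).
  rewrite eq_w -cats1 hom_cat; have -> : hom [:: a] = block a by rewrite /hom /= cats0.
  by rewrite /block {2}eq_d /root_str; cats.
rewrite /language /= eq_h.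
apply: (@derives_plain Start [:: nt AnyString; tm 'c; nt RootChecks]) => //.
apply: (derives_cat erefl (derives_AnyString _ _)); apply/derives_term/derives_seq1.
apply: (@drv_checks _ _ _ _ [::] (size w)) => //.
- by move=> D /hold_Ds/(holds_sat_complete.1)[].
- by rewrite eq_h; cats; rewrite cats0.
- by rewrite eq_w size_rcons; nes; rewrite ne_hom ne_dict; lia.
apply: (@derives_plain RootChecks [:: tm 'd; tm 'd; tm 'd; nt NoLetter]) => //.
by apply/derives_term/derives_term/derives_term/derives_seq1/drv_NoLetter; case: ne_pq.
Qed.
End Completeness.
End Encoding.

(** * Reduction of a grammar to a list of cells *)

(** Until it stabilises, an inflationary iteration gains an element in each step, and there are only
    [#|T|] of them. *)
Lemma iter_stable (T : finType) (f : {set T} -> {set T}) :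
  (forall A : {set T}, A \subset f A) ->
  f (iter #|T| f finset.set0) = iter #|T| f finset.set0.
Proof.
move=> subf; pose A n := iter n f finset.set0.
have [] : #|T| <= #|A #|T| | \/ f (A #|T|) = A #|T|; last by [].
  elim: #|T| => [|n [le_n|eqA]]; first by left.
    have [eqA|neA] := eqVneq (f (A n)) (A n); first by right; rewrite /A /= eqA.
    left; apply: leq_ltn_trans le_n _; apply: proper_card.
    by rewrite /A /= finset.properEneq subf eq_sym neA.
  by right; rewrite /A /= eqA.
move=> le_A; have AT : A #|T| = [set: T]%SET by apply/eqP; rewrite eqEcard finset.subsetT cardsT.
by apply/eqP; rewrite eq_sym finset.eqEsubset subf -/(A _) {2}AT finset.subsetT.
Qed.

Section NormalForm.
Variables (Sigma : finType) (G : grammar Sigma).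
Notation sym := (symbol Sigma (nonterm G)).
Notation drv A u v := (@derives_seq _ G A u v).

Definition conjuncts (r : rule Sigma (nonterm G)) :=
  base_conjuncts r ++ left_conjuncts r ++ extleft_conjuncts r.
(** The bound makes the set of items finite and closed under suffixes, as splitting off the first
    symbol requires. The successor admits one-symbol strings even if all conjuncts are empty. *)
Definition width := (\max_(r <- rules G) \max_(A <- conjuncts r) size A).+1.
Definition item := width.-bseq sym.
Definition to_item (A : seq sym) : item := insub_bseq width A.

Lemma to_itemK A : size A <= width -> to_item A = A :> seq sym.
Proof. by move=> le_A; rewrite /to_item /insub_bseq insubdK. Qed.

Lemma conjunct_width r A : r \in rules G -> A \in conjuncts r -> size A <= width.
Proof.
move=> r_in A_in; apply: leqW; apply: leq_trans (leq_bigmax_seq (F := size) _ A_in isT) _.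
exact: (leq_bigmax_seq (F := fun r => \max_(A <- conjuncts r) size A) _ r_in isT).
Qed.

(** By [iter_stable] this length suffices for an inflationary iteration on sets of items. The links
    of a chain are arbitrary; codes verify them. *)
Definition chain := (#|{: item}|.-tuple {set item})%type.
(* The atom (X :: Xs, L, c, R) stands for a splitting into X and Xs under the
   assumptions L and R on tau at the two ends, where the chain c justifies the
   assumption on tau at the splitting position. *)
Definition pairid := (item * {set item} * chain * {set item})%type.
Definition atom := (Sigma + pairid)%type.
Definition aid (x : atom) : nat := enum_rank x.

Lemma aid_inj : injective aid.
Proof. by move=> x y /ord_inj/enum_rank_inj. Qed.

(* [eps L A]: A derives the empty string after any u with [tau u = L].
   [ent L R F A]: A derives any nonempty v after u with [tau u = L] and
   [tau (u ++ v) = R], provided that the atoms in F hold at (u, v). *)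
Inductive eps (L : {set item}) : seq sym -> Prop :=
| EpsNil : eps L [::]
| EpsCons r Xs : r \in rules G ->
    (forall A, A \in base_conjuncts r -> eps L A) ->
    (forall A, A \in left_conjuncts r -> to_item A \in L) ->
    (forall A, A \in extleft_conjuncts r -> to_item A \in L) ->
    eps L Xs -> eps L (inr (lhs r) :: Xs).

Inductive ent (L R : {set item}) (F : {set atom}) : seq sym -> Prop :=
| EntLetter a : inl a \in F -> ent L R F [:: inl a]
| EntRule r : r \in rules G ->
    (forall A, A \in base_conjuncts r -> ent L R F A) ->
    (forall A, A \in left_conjuncts r -> to_item A \in L) ->
    (forall A, A \in extleft_conjuncts r -> to_item A \in R) ->
    ent L R F [:: inr (lhs r)]
| EntLeft X Xs : eps L [:: X] -> ent L R F Xs -> ent L R F (X :: Xs)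
| EntRight X Xs : ent L R F [:: X] -> eps R Xs -> ent L R F (X :: Xs)
| EntPair X Xs (A : item) (c : chain) : A = X :: Xs :> seq sym ->
    inr (A, L, c, R) \in F -> ent L R F (X :: Xs).

Definition ent_code (A : seq sym) (L R : {set item}) : code :=
  [seq map aid (enum F) | F : {set atom} <- enum {: {set atom}} & `[< ent L R F A >]].

Definition tau (u : seq Sigma) : {set item} :=
  [set A : item | `[< drv A [::] u >]].

(** A link from [L] to [R] asks for each new item separately. The factors start at position 0, where
    the true set [tau [::]] depends on [G] alone. *)
Fixpoint chain_codes (L : {set item}) (c : seq {set item}) : seq code :=
  if c is R :: c' then
    [seq ent_code (A : item) (tau [::]) L | A in R :\: L] ++ chain_codes R c'
  else [::].

Definition top (c : seq {set item}) := last finset.set0 c.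

(** [ent] never concludes the empty string, so an item with fewer than two symbols yields a code
    without conjunctions, and its cell never applies. *)
Definition cell_of (k : pairid) : cell :=
  let: (A, L, c, R) := k in
  (ent_code (take 1 A) L (top c), aid (inr k), chain_codes finset.set0 c,
   ent_code (behead A) (top c) R).

Definition nf_cells := [seq cell_of k | k <- enum {: pairid}].
Definition nf_roots :=
  [seq chain_codes finset.set0 c | c : chain <- enum {: chain} & to_item [:: inr (start G)] \in top c].
Definition nf_letter_id (a : Sigma) := aid (inl a).

Lemma tauP (A : seq sym) u : size A <= width -> reflect (drv A [::] u) (to_item A \in tau u).
Proof. by move=> le_A; rewrite inE to_itemK //; apply: asboolP. Qed.

(** Every rule has a base conjunct, so descending through base conjuncts ends at a letter or pair
    atom in [F]. *)
Lemma ent_neq0 L R F A : ent L R F A -> F != finset.set0.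
Proof.
elim=> {A} [a aF|r r_in _ IH _ _|//|//|X Xs A c _ cF];
  try by apply/finset.set0Pn; eexists; eassumption.
have /allP/(_ r r_in) := rules_base G.
by case: (base_conjuncts r) IH => // A bs IH _; apply: (IH A); rewrite mem_head.
Qed.

Lemma ent_codeP A L R ks : reflect (exists2 F, ent L R F A & ks = map aid (enum F))
  (ks \in ent_code A L R).
Proof.
apply: (iffP mapP) => [[F]|[F entF ->]].
  by rewrite mem_filter => /andP[/asboolP]; exists F.
by exists F => //; rewrite mem_filter mem_enum andbT; apply/asboolP.
Qed.

Lemma ent_code_nonempty A L R : [::] \notin ent_code A L R.
Proof.
apply/ent_codeP => -[F /ent_neq0/finset.set0Pn[x xF]].
have: x \in enum F by rewrite mem_enum.
by case: (enum F).
Qed.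

Lemma nf_cells_nonempty B n Ds C : (B, n, Ds, C) \in nf_cells ->
  [::] \notin B /\ [::] \notin C.
Proof.
by case/mapP=> [[[[A L] c] R] _ [-> _ _ ->]]; rewrite !ent_code_nonempty.
Qed.

(** * Soundness of the cells on a fixed word *)

Section Word.
Variable w : seq Sigma.
Implicit Types (L R : {set item}) (A Xs : seq sym) (F : {set atom}) (u v : seq Sigma).
Notation hold := (holds nf_letter_id nf_cells w).
Notation satn := (sat nf_letter_id nf_cells w).
Notation seg i j := (drop i (take j w)).
Notation drvp A i j := (drv A (take i w) (seg i j)).

Lemma take_seg i j : i <= j -> take i w ++ seg i j = take j w.
Proof. by move=> le_ij; rewrite -[RHS](cat_take_drop i) take_takel. Qed.

Lemma seg_cat i m j : i <= m -> m <= j -> seg i m ++ seg m j = seg i j.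
Proof.
move=> le_im le_mj; have: take i w ++ (seg i m ++ seg m j) = take i w ++ seg i j.
  by rewrite catA !take_seg // (leq_trans le_im).
by move/(congr1 (drop (size (take i w)))); rewrite !drop_size_cat.
Qed.

Lemma eps_sound L u A : L \subset tau u -> eps L A -> drv A u [::].
Proof.
move=> subL; elim=> {A} [|r Xs r_in _ IHb IHl IHe _ IHXs]; first exact: derives_nil.
have le_r A := @conjunct_width r A r_in.
apply: (@derives_cat _ _ _ _ u [::] [::] [::]) => //; last by rewrite cats0.
apply: derives_rule => // [A A_in|A A_in].
  by apply/tauP/(fintype.subsetP subL)/IHl => //; apply: le_r; rewrite !mem_cat A_in !orbT.
rewrite cats0.
by apply/tauP/(fintype.subsetP subL)/IHe => //; apply: le_r; rewrite !mem_cat A_in !orbT.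
Qed.

(** Inclusion in the true sets is enough, because rules use contexts only positively. *)
Definition atom_holds (x : atom) i j : Prop :=
  match x with
  | inl a => seg i j = [:: a]
  | inr (A, L, c, R) => L \subset tau (take i w) -> R \subset tau (take j w) ->
      forall X Xs, A = X :: Xs :> seq sym -> drvp (X :: Xs) i j
  end.

Lemma ent_sound L R F A i j : i <= j -> L \subset tau (take i w) ->
  R \subset tau (take j w) -> (forall x, x \in F -> atom_holds x i j) ->
  ent L R F A -> drvp A i j.
Proof.
move=> le_ij subL subR F_ok.
elim=> {A} [a /F_ok /= ->|r r_in _ IHb IHl IHe|X Xs epsX _ IHXs|X Xs _ IHX epsXs|X Xs A c eqA].
- exact/derives_seq1/derives_axiom.
- have le_r A := @conjunct_width r A r_in.
  apply/derives_seq1; apply: derives_rule => // [A A_in|A A_in].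
    by apply/tauP/(fintype.subsetP subL)/IHl => //; apply: le_r; rewrite !mem_cat A_in !orbT.
  rewrite take_seg //.
  by apply/tauP/(fintype.subsetP subR)/IHe => //; apply: le_r; rewrite !mem_cat A_in !orbT.
- have /derives_seq1 dX := eps_sound subL epsX.
  by apply: (derives_cat (v1 := [::]) erefl dX); rewrite cats0.
- move/derives_seq1 in IHX; apply: (derives_cat (v2 := [::]) _ IHX); first by rewrite cats0.
  by rewrite take_seg //; apply: eps_sound epsXs.
by move/F_ok => /(_ subL subR X Xs eqA).
Qed.

(** Each set of the chain stays within [tau]: a new item of [R] is derived through a code that
    assumes only [L]. *)
Lemma chain_sound m L c : L \subset tau (take m w) ->
    (forall D, D \in chain_codes L c -> forall A L R, D = ent_code A L R ->
       L \subset tau (take 0 w) -> R \subset tau (take m w) -> drvp A 0 m) ->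
  last L c \subset tau (take m w).
Proof.
elim: c L => //= R c IHc L subL codes_ok.
apply: IHc => [|D D_in]; last by apply: codes_ok; rewrite mem_cat D_in orbT.
apply/fintype.subsetP=> A AR; case: (boolP (A \in L)) => [/(fintype.subsetP subL)//|AL].
rewrite inE; apply/asboolP.
have := codes_ok (ent_code A (tau [::]) L) _ A (tau [::]) L erefl.
rewrite take0 drop0; apply=> //.
rewrite mem_cat; apply/orP; left; apply/mapP; exists A => //.
by rewrite mem_enum finset.in_setD AL.
Qed.

(** Different triples may yield the same code, so a code that holds is shown sound for all of
    them. *)
Lemma nf_sound :
  (forall D i j, hold D i j -> forall A L R, D = ent_code A L R ->
     L \subset tau (take i w) -> R \subset tau (take j w) -> drvp A i j) /\
  (forall k i j, satn k i j -> forall x, k = aid x -> atom_holds x i j).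
Proof.
have [hold_lt sat_lt] := @holds_sat_lt _ nf_letter_id _ w nf_cells_nonempty.
apply: holds_combined => [D ks i j ks_D sat_ks IH A L R eq_D|w1 a w2 eq_w x /aid_inj <-|].
- rewrite eq_D in ks_D; case/ent_codeP: ks_D => F entF eq_ks subL subR.
  have F_ok x : x \in F -> satn (aid x) i j /\ atom_holds x i j.
    by move=> xF; split; [apply: sat_ks | apply: IH (erefl _)];
       rewrite eq_ks map_f // mem_enum.
  have [x xF] := finset.set0Pn _ (ent_neq0 entF).
  apply: ent_sound entF => // [|y /F_ok[]//].
  by apply/ltnW/(sat_lt (aid x)); case: (F_ok x xF).
- rewrite /= eq_w take_cat ltnNge leqnSn /= subSnn /= take0.
  by rewrite drop_size_cat.
move=> B n Ds C i m j /mapP[[[[A L] c] R] _ [-> -> -> ->]].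
move=> /[dup] /hold_lt/(_ (ent_code_nonempty _ _ _)) lt_im _ IHB.
move=> /[dup] /hold_lt/(_ (ent_code_nonempty _ _ _)) lt_mj _ IHC.
move=> _ IHDs x /aid_inj <- /= subL subR X Xs eqA.
have subc : top c \subset tau (take m w).
  by apply: chain_sound => // ; rewrite finset.sub0set.
have:= IHC _ _ _ erefl subc subR; rewrite eqA /= => dXs.
have:= IHB _ _ _ erefl subL subc; rewrite eqA /= take0 => /derives_seq1 dX.
apply: (derives_cat _ dX); last by rewrite take_seg ?(ltnW lt_im) //; apply: dXs.
by rewrite seg_cat // ltnW.
Qed.

Lemma nf_root_sound Ds : Ds \in nf_roots ->
  (forall D, D \in Ds -> hold D 0 (size w)) -> language G w.
Proof.
case/mapP=> c; rewrite mem_filter => /andP[start_c _] -> hold_Ds.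
have /fintype.subsetP/(_ _ start_c) : top c \subset tau (take (size w) w).
  apply: chain_sound => [|D /hold_Ds/(nf_sound.1)//]; exact: finset.sub0set.
by rewrite take_size => /tauP; move/(_ isT)/derives_seq1.
Qed.

Lemma eps_cat L X Xs : eps L [:: X] -> eps L Xs -> eps L (X :: Xs).
Proof.
move E: [:: X] => Y epsY; case: epsY E => // r Ys r_in epsb inl inle _ [-> _].
exact: EpsCons.
Qed.

Lemma eps_complete A u : drv A u [::] -> size A <= width -> eps (tau u) A.
Proof.
suff: (forall X u v, derives (G := G) X u v -> v = [::] -> eps (tau u) [:: X]) /\
      (forall A u v, drv A u v -> v = [::] -> size A <= width -> eps (tau u) A).
  by case=> _ H d; apply: H d erefl.
apply: derives_combined => {A u} [//|r u v r_in _ IHb dl _ de _ v0|u _ _|].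
- have le_r A := @conjunct_width r A r_in.
  subst v; apply: EpsCons => // [A A_in|A A_in|A A_in|]; last exact: EpsNil.
  + by apply: IHb => //; apply: le_r; rewrite !mem_cat A_in.
  + by apply/tauP/dl => //; apply: le_r; rewrite !mem_cat A_in !orbT.
  + move/(_ A A_in): de; rewrite cats0 => de.
    by apply/tauP => //; apply: le_r; rewrite !mem_cat A_in !orbT.
- exact: EpsNil.
move=> X Xs u [|//] [|//] _ IHX _ IHXs _ /ltnW le_Xs; rewrite cats0 in IHXs.
by apply: eps_cat; [apply: IHX | apply: IHXs].
Qed.

(** * Completeness at one position, given completeness at the smaller ones *)

Section Position.
Variable j : nat.
Hypotheses (j_gt0 : 0 < j) (le_jw : j <= size w).

Definition true_atoms i : {set atom} := [set x | `[< satn (aid x) i j >]].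

Lemma ent_hold L R A i : ent L R (true_atoms i) A -> hold (ent_code A L R) i j.
Proof.
move=> entA; apply: (@Holds _ _ _ _ _ (map aid (enum (true_atoms i)))).
  by apply/ent_codeP; exists (true_atoms i).
by move=> k /mapP[x]; rewrite mem_enum inE => /asboolP + ->.
Qed.

Definition step R : {set item} :=
  (R :|: [set A : item | `[< hold (ent_code A (tau [::]) R) 0 j >]])%SET.

(* [step] is made inflationary, so that its iterates stabilise whether or not
   the set of derivable items is monotone in R. *)
Definition limit := iter #|{: item}| step finset.set0.

Lemma step_limit : step limit = limit.
Proof. by apply: iter_stable => R; apply: finset.subsetUl. Qed.

(** The empty initial set is left out because [chain_codes] is started from it. *)
Definition limit_chain : chain :=
  @Tuple _ _ (traject step (step finset.set0) #|{: item}|)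
    (introT eqP (size_traject _ _ _)).

Lemma top_limit_chain : top limit_chain = limit.
Proof. exact: last_traject. Qed.

Lemma limit_chain_codes D : D \in chain_codes finset.set0 limit_chain -> hold D 0 j.
Proof.
rewrite /=; elim: #|_| finset.set0 => //= n IHn R; rewrite mem_cat => /orP[/mapP[A]|/IHn//].
rewrite mem_enum !inE => /andP[AR].
by rewrite (negPf AR) /= => /asboolP + ->.
Qed.

Lemma limit_sub_tau : limit \subset tau (take j w).
Proof.
rewrite -top_limit_chain; apply: chain_sound => [|D /limit_chain_codes/(nf_sound.1)//].
exact: finset.sub0set.
Qed.

Definition complete_at k (c : chain) := [/\ top c = tau (take k w),
  forall D, D \in chain_codes finset.set0 c -> hold D 0 k &
  forall i A, i < k -> size A <= width -> drvp A i k ->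
    hold (ent_code A (tau (take i w)) (tau (take k w))) i k].

Hypothesis shorter : forall k, 0 < k -> k < j -> exists c, complete_at k c.

Lemma ent_limit A : size A <= width ->
  ent (tau [::]) limit (true_atoms 0) A -> to_item A \in limit.
Proof.
move=> le_A entA; rewrite -step_limit !inE; apply/orP; right; apply/asboolP.
by rewrite to_itemK //; apply: ent_hold.
Qed.

(** At the right end [limit] stands in for [tau (take j w)], as their equality in [limitE] rests on
    this statement. Empty [v] is separate, since atoms speak of nonempty factors. *)
Definition limit_complete A u v := drv A u v /\ (size A <= width ->
  (v <> [::] -> u ++ v = take j w -> ent (tau u) limit (true_atoms (size u)) A) /\
  (v = [::] -> u = take j w -> eps limit A)).

Lemma limit_complete_item A u : limit_complete A [::] u -> size A <= width ->
  u = take j w -> to_item A \in limit.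
Proof.
move=> [_ IH] le_A eq_u; apply: ent_limit => //; apply: (IH le_A).1 => // u0.
by move: (congr1 size eq_u); rewrite u0 size_takel //=; lia.
Qed.

(** Contexts over the whole prefix of length [j] enter [limit] because it is closed under [step];
    this breaks the circle between what holds at [j] and what is assumed there. Proper splits use
    [shorter]. *)
Lemma derives_limit_complete :
  (forall X u v, derives (G := G) X u v -> limit_complete [:: X] u v) /\
  (forall A u v, drv A u v -> limit_complete A u v).
Proof.
apply: derives_combined => [a x|r u v r_in db IHb dl IHl de IHe|u|X Xs u v1 v2 dX IHX dXs IHXs].
- split; first exact/derives_seq1/derives_axiom.
  move=> _; split=> // _ eq_xa; apply: EntLetter; rewrite inE; apply/asboolP.
  have -> : j = (size x).+1 by rewrite -(size_takel le_jw) -eq_xa size_cat addn1.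
  by apply: (@SatLetter _ _ _ _ x a (drop j w)); rewrite -[LHS](cat_take_drop j) -eq_xa -catA.
- have le_r A := @conjunct_width r A r_in.
  split; first by apply/derives_seq1/derives_rule.
  move=> _; split=> [v0 eq_uv|v0 eq_u].
    apply: EntRule => // A A_in.
    + by apply: ((IHb A A_in).2 _).1 => //; apply: le_r; rewrite mem_cat A_in.
    + by apply/tauP/dl => //; apply: le_r; rewrite !mem_cat A_in !orbT.
    + by apply: limit_complete_item (IHe A A_in) _ eq_uv; apply: le_r; rewrite !mem_cat A_in !orbT.
  (* With [v] empty the left context is itself the prefix of length [j], so both kinds of contexts
     lie in [limit]. *)
  subst v; apply: EpsCons => // [A A_in|A A_in|A A_in|]; last exact: EpsNil.
  + by apply: ((IHb A A_in).2 _).2 => //; apply: le_r; rewrite mem_cat A_in.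
  + by apply: limit_complete_item (IHl A A_in) _ eq_u; apply: le_r; rewrite !mem_cat A_in !orbT.
  + apply: limit_complete_item (IHe A A_in) _ _; last by rewrite cats0.
    by apply: le_r; rewrite !mem_cat A_in !orbT.
- by split; [apply: derives_nil | split=> // _ _; apply: EpsNil].
split=> [|le_A]; first exact: derives_cons.
have le_Xs : size Xs <= width by apply: ltnW.
have {IHX} [dX1 /(_ isT)[IHX IHX0]] := IHX; have {IHXs} [_ /(_ le_Xs)[IHXs IHXs0]] := IHXs.
split=> [v0 eq_uv|].
  have [v10|v10] := eqVneq v1 [::].
    subst v1; rewrite cats0 in IHXs; apply: EntLeft; last by apply: IHXs.
    exact: eps_complete dX1 _.
  have [v20|v20] := eqVneq v2 [::].
    subst v2; rewrite cats0 in eq_uv v0; apply: EntRight; first exact: IHX.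
    exact: IHXs0.
  have eq_uv' : (u ++ v1) ++ v2 = take j w by rewrite -catA.
  pose k := size (u ++ v1).
  have sz_v1 : 0 < size v1 by rewrite lt0n size_eq0.
  have sz_v2 : 0 < size v2 by rewrite lt0n size_eq0.
  have eq_j : j = k + size v2 by rewrite -(size_takel le_jw) -eq_uv' size_cat.
  have eq_k : take k w = u ++ v1.
    by rewrite -(@take_takel _ k j) -?eq_uv' ?take_size_cat // eq_j leq_addr.
  have lt_ik : size u < k by rewrite /k size_cat; lia.
  have [||c [top_c codes_c hold_c]] := @shorter k; [lia|lia|].
  have eq_u : take (size u) w = u by rewrite -(@take_takel _ _ k) ?eq_k ?take_size_cat // ltnW.
  apply: (@EntPair _ _ _ _ _ (to_item (X :: Xs)) c); rewrite ?to_itemK // inE; apply/asboolP.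
  have in_cells : cell_of (to_item (X :: Xs), tau u, c, limit) \in nf_cells.
    by rewrite map_f // mem_enum.
  apply: (SatPair in_cells (m := k)); rewrite ?to_itemK //= ?take0 top_c.
    by have := hold_c (size u) [:: X] lt_ik isT; rewrite eq_u; apply; rewrite eq_k drop_size_cat.
  (* The right part still ends at [j], so its code comes from the induction on the derivation, not
     from [shorter]. *)
  by apply: ent_hold; rewrite eq_k; apply: IHXs => // v20'; rewrite v20' in v20.
move/eqP; rewrite -size_eq0 size_cat addn_eq0 !size_eq0 => /andP[/eqP v10 /eqP v20] eq_u.
apply: eps_cat; first by apply: IHX0.
by apply: IHXs0 => //; rewrite v10 cats0.
Qed.

Lemma limitE : limit = tau (take j w).
Proof.
apply/eqP; rewrite finset.eqEsubset limit_sub_tau /=; apply/fintype.subsetP=> A.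
rewrite inE => /asboolP/derives_limit_complete.2 goalA.
have -> : A = to_item A by apply: val_inj; rewrite /= to_itemK // size_bseq.
by apply: limit_complete_item goalA _ erefl; apply: size_bseq.
Qed.

Lemma complete_at_limit : complete_at j limit_chain.
Proof.
split=> [|D|i A lt_ij le_A dA].
- by rewrite top_limit_chain limitE.
- exact: limit_chain_codes.
apply: ent_hold; rewrite -limitE.
have := (((derives_limit_complete.2 _ _ _ dA).2 le_A).1 _ (take_seg (ltnW lt_ij))).
have sz_i : size (take i w) = i by rewrite size_takel //; lia.
rewrite sz_i; apply => /(congr1 size)/=; rewrite size_drop size_takel //; lia.
Qed.

End Position.

Lemma nf_complete k : 0 < k -> k <= size w -> exists c, complete_at k c.
Proof.
elim/ltn_ind: k => k IHk k_gt0 le_kw; exists (limit_chain k).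
apply: complete_at_limit => // m m_gt0 lt_mk.
by apply: IHk => //; apply: leq_trans (ltnW lt_mk) le_kw.
Qed.

Lemma nf_root_complete : w != [::] -> language G w ->
  exists2 Ds, Ds \in nf_roots & forall D, D \in Ds -> hold D 0 (size w).
Proof.
move=> w0 dw; have [||c [top_c codes_c _]] := @nf_complete (size w) => //.
  by rewrite lt0n size_eq0.
exists (chain_codes finset.set0 c) => //; apply/mapP; exists c => //.
rewrite mem_filter mem_enum andbT top_c take_size.
by apply/tauP => //; apply/derives_seq1.
Qed.
End Word.
End NormalForm.

(** * Choice of the homomorphism and treatment of the empty string *)

Lemma hom_language (Sigma : finType) (G : grammar Sigma) (w : seq Sigma) :
  language G0 (hom (@nf_letter_id _ G) (nf_cells G) (nf_roots G) w) <->
  w != [::] /\ language G w.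
Proof.
split=> [/hom_sound[w_neq0 [Ds /nf_root_sound Ds_ok /Ds_ok]]|[w_neq0]] //.
case/(nf_root_complete w_neq0) => Ds Ds_in hold_Ds.
by apply: hom_complete w_neq0 Ds_in hold_Ds; apply: nf_cells_nonempty.
Qed.

Local Open Scope classical_set_scope.

Theorem theorem2 :
  exists L0 : set (seq sigma0),
    described_by_left_contexts L0 /\
    forall (Sigma : finType) (L : set (seq Sigma)),
      described_by_left_contexts L ->
      exists h : seq Sigma -> seq sigma0,
        string_morphism h /\
        (~ L [::] -> L = h @^-1` L0) /\
        (L [::] -> L = h @^-1` (L0 `|` [set [::]])).
Proof.
exists (language G0); split; first by exists G0.
move=> Sigma _ [G ->].
exists (hom (@nf_letter_id _ G) (nf_cells G) (nf_roots G)); split.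
  by split=> //; apply: hom_cat.
split=> eps_L; apply/seteqP; split=> w /=.
- by move=> Lw; apply/hom_language; split=> //; apply: contra_notN eps_L => /eqP <-.
- by case/hom_language.
- by have [->|w_neq0] := eqVneq w [::]; [right | left; apply/hom_language].
(* The image has one ['e] per letter, so only the empty word has an empty image. *)
case=> [/hom_language[]//|/(congr1 ne)].
by rewrite ne_hom => /size0nil ->.
Qed.
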